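(* Let $k\in\mathbb N$, $\mathbf y\in\mathbb R^k$, $N\in\mathbb N$, $0<d\leqslant1/2$, and let $\tau>0$ be fixed. Let $\mathbf d=(d_1,\dots,d_k)\in(0,1/2]^k$ satisfy $N^{-\tau}d\ll d_j\ll N^{\tau}d$ for $1\leqslant j\leqslant k$, and for each integer $n\in[N,2N)$ let $A_n^*(\cdot)=A_n^*(\cdot;\mathbf d)$. Let $\mu$ be a Borel probability measure on $[0,1]^k$ with $\dim_{\ell^1}(\mu)=\kappa$. Then for any fixed $\varepsilon>0$, \[ \Big|\sum_{N\leqslant n<2N}\big(\mu(A_n^* )-\lambda(A_n^* )\big)\Big|\ll N^{k+(2k+\varepsilon)\tau+\varepsilon}\,d^{\kappa-\varepsilon}, \] with implied constant independent of $N$, $d$, $\mathbf d$ and $\mathbf y$.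
   Context: Let $w:\mathbb R\to[0,1]$ be a fixed non-zero smooth (Schwartz-class) bump function supported on $[-2,2]$. For $\mathbf d\in(0,1/2]^k$ put $w_{\mathcal R(\mathbf d)}(\mathbf x)=\prod_{j=1}^k w(x_j/d_j)$ and \[ A_n^*(\mathbf x;\mathbf d)=\sum_{\mathbf a\in\mathbb Z^k}w_{\mathcal R(\mathbf d)}\Big(\mathbf x-\frac{\mathbf a+\mathbf y}{n}\Big). \] $\lambda$ is Lebesgue measure on $[0,1]^k$ and $\nu(f)=\int_{[0,1]^k}f\,d\nu$. For a Borel probability measure $\nu$ on $[0,1]^k$, $\hat\nu({\boldsymbol{\xi}})=\int e^{-2\pi i{\boldsymbol{\xi}}\cdot\mathbf x}\,d\nu(\mathbf x)$ and $\dim_{\ell^1}(\nu)=\sup\{s\geqslant0:\sum_{{\boldsymbol{\xi}}\in\mathbb Z^k,\|{\boldsymbol{\xi}}\|_\infty\leqslant Q}|\hat\nu({\boldsymbol{\xi}})|\ll Q^{k-s}\ (Q\geqslant1)\}$. The implied constants in the hypotheses on $d_j$ are fixed. *)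

(* Defs.v *)
From HB Require Import structures.
From mathcomp Require Import all_boot all_order all_algebra.
From mathcomp Require Import all_classical all_reals all_analysis.
Set Implicit Arguments. Unset Strict Implicit. Unset Printing Implicit Defensive.
Import Order.TTheory GRing.Theory Num.Theory.
Import numFieldNormedType.Exports.
Local Open Scope classical_set_scope.
Local Open Scope ring_scope.

Definition vecR (R : realType) (k : nat) : pointedType := ('I_k -> R)%type.

Definition boxes (R : realType) (k : nat) : set (set (vecR R k)) :=
  [set B | exists I : 'I_k -> set R,
      (forall i, measurable (I i)) /\ B = [set x | forall i, I i (x i)]].

(* R^k with its Borel sigma-algebra (generated by products of Borel sets). *)
Definition Rk (R : realType) (k : nat) := g_sigma_algebraType (@boxes R k).

Definition unit_cube (R : realType) (k : nat) : set (Rk R k) :=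
  [set x | forall i, 0 <= x i <= 1].


(* The fixed bump function: smooth (all derivatives exist everywhere), values in
   [0,1], support in [-2,2], not identically zero. With compact support,
   smoothness is equivalent to Schwartz class. *)
Definition bump_fun (R : realType) (w : R -> R) : Prop :=
  [/\ (forall x, 0 <= w x <= 1),
      (forall x, w x != 0 -> -2 <= x <= 2),
      (exists x, w x != 0) &
      (forall (m : nat) (x : R), derivable (derive1n m w) x 1)].

Definition wR (R : realType) (k : nat) (w : R -> R) (dd : 'I_k -> R)
    (x : 'I_k -> R) : R :=
  \prod_(j < k) w (x j / dd j).

Definition Astar (R : realType) (k : nat) (w : R -> R) (n : nat)
    (dd y : 'I_k -> R) (x : Rk R k) : R :=
  fine (\esum_(a in [set: 'I_k -> int])
          (wR w dd (fun j => x j - ((a j)%:~R + y j) / n%:R))%:E).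

Definition meas_int (R : realType) (k : nat) (nu : probability (Rk R k) R)
    (f : Rk R k -> R) : R :=
  fine (\int[nu]_(x in @unit_cube R k) (f x)%:E)%E.

Definition upd (R : realType) (z : nat -> R) (m : nat) (t : R) : nat -> R :=
  fun i => if i == m then t else z i.

Fixpoint lebI (R : realType) (n : nat) (F : (nat -> R) -> \bar R) (z : nat -> R)
  : \bar R :=
  match n with
  | 0 => F z
  | m.+1 => (\int[@lebesgue_measure R]_(t in `[0%R, 1%R]) lebI m F (upd z m t))%E
  end.

(* lambda(f) = int_{[0,1]^k} f dlambda, Lebesgue measure on [0,1]^k
   (computed as an iterated integral, Fubini--Tonelli) *)
Definition leb_int (R : realType) (k : nat) (f : Rk R k -> R) : R :=
  fine (lebI k (fun z => (f (fun j : 'I_k => z j))%:E) (fun _ => 0)).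

(* Fourier coefficient hat nu(xi) = int e^{-2 pi i xi.x} dnu(x), xi in Z^k,
   given by its real and imaginary parts. *)
Definition xi_dot (R : realType) (k : nat) (xi : 'I_k -> int) (x : 'I_k -> R) : R :=
  \sum_(j < k) (xi j)%:~R * x j.

Definition fourier_re (R : realType) (k : nat) (nu : probability (Rk R k) R)
    (xi : 'I_k -> int) : R :=
  meas_int nu (fun x => cos (2 * pi * xi_dot xi x)).

Definition fourier_im (R : realType) (k : nat) (nu : probability (Rk R k) R)
    (xi : 'I_k -> int) : R :=
  - meas_int nu (fun x => sin (2 * pi * xi_dot xi x)).

Definition fourier_abs (R : realType) (k : nat) (nu : probability (Rk R k) R)
    (xi : 'I_k -> int) : R :=
  Num.sqrt (fourier_re nu xi ^+ 2 + fourier_im nu xi ^+ 2).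

Definition freq_box (k : nat) (R : realType) (Q : R) : set ('I_k -> int) :=
  [set xi | forall j, (`|xi j|)%:~R <= Q].

Definition dim_l1 (R : realType) (k : nat) (nu : probability (Rk R k) R) : R :=
  sup [set s : R | 0 <= s /\
        exists C : R, forall Q : R, 1 <= Q ->
          (\esum_(xi in @freq_box k R Q) (fourier_abs nu xi)%:E
             <= (C * Q `^ (k%:R - s))%:E)%E].

(* Main.v *)
Require Import Defs.
From HB Require Import structures.
From mathcomp Require Import all_boot all_order all_algebra.
From mathcomp Require Import all_classical all_reals all_analysis.
From mathcomp Require Import measurable_realfun complex.
From mathcomp Require Import ring lra zify.
Import Order.TTheory GRing.Theory Num.Theory.
Import numFieldNormedType.Exports.
Import ComplexField.Normc.
Set Implicit Arguments.
Unset Strict Implicit.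
Unset Printing Implicit Defensive.
Local Open Scope classical_set_scope.
Local Open Scope ring_scope.

(** Write [A_n] for [Astar w n dd y]. On the cube, [A_n] is a product of one-variable
[1/n]-periodic functions. Each factor is uniformly approximated by a trigonometric
polynomial whose coefficients [c_m] are [O(D (1 + D |m|)^-M)] with [D = n d_j]:
interpolate at the grid [s / P] with [P] odd and large, so that the coefficients are
discrete Fourier transforms of samples of [w], summation by parts gives the decay, and a
Lipschitz bound gives the approximation off the grid. Multiplying out and integrating, the
zero frequency reproduces [lambda(A_n)], so [mu(A_n) - lambda(A_n)] is at most a sum of
[|c_xi| |mu^(n xi)|] over [xi <> 0]. When [n] runs over [[N, 2N)], a frequency [m = n xi]
occurs at most as often as [max_j |m_j|] has divisors, i.e. [O(|m|^e)] times. A dyadic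
decomposition in [|m|] around [H = N^tau / (c d)] and the bounds [sum_(|m| <= Q) |mu^(m)|
= O(Q^(k - s))], for [s] slightly below the dimension, then give the result. *)

(** * The complex exponential *)

(** Interpolating on a finite grid replaces Poisson summation and the convergence of Fourier series:
    every trigonometric sum is finite, at the price of an error that a finer grid makes as small as
    desired. Only the degree may depend on [n], [y] and that error; the size and decay of the
    coefficients must be uniform in all of them and in [D], which can be small or large. Hence the
    estimates are arranged so that the grid step cancels.

    The loss [2 * k * tau] has two sources. The upper bounds on the [d_j] enter through the size of
    the coefficients, a product of [k] factors [O(n d_j)], and cost [N^(k tau)]. The lower bounds
    enter through the cutoff [H], beyond which some factor decays; [H] is raised to about [k - s],
    at most [k], which costs another [N^(k tau)]. For [d] the same two sources give [d^k] and
    [d^(s - k)], hence [d^s]. The losses [eps] pay for the divisor bound and for taking [s] below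
    the dimension. *)

Section complex_norm.
Variable R : rcfType.
Implicit Types (x : R) (z : R[i]).

Lemma normc_real x : normc (x%:C)%C = `|x|.
Proof. by rewrite /normc /= expr0n /= addr0 sqrtr_sqr. Qed.

Lemma normc_ge0 z : 0 <= normc z.
Proof. by case: z => a b; rewrite /normc sqrtr_ge0. Qed.

Lemma sqr_normcE z : normc z ^+ 2 = complex.Re z ^+ 2 + complex.Im z ^+ 2.
Proof. by case: z => a b; rewrite /normc /= sqr_sqrtr // addr_ge0 ?sqr_ge0. Qed.

Lemma le_normc_sum (I : Type) (r : seq I) (P : pred I) (F : I -> R[i]) :
  normc (\sum_(i <- r | P i) F i) <= \sum_(i <- r | P i) normc (F i).
Proof.
apply: (big_ind2 (fun z x => normc z <= x)) => //.
- by rewrite normc0.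
- by move=> z1 x1 z2 x2 h1 h2; apply: le_trans (le_normcD _ _) (lerD h1 h2).
Qed.

Lemma normc_prod (I : Type) (r : seq I) (P : pred I) (F : I -> R[i]) :
  normc (\prod_(i <- r | P i) F i) = \prod_(i <- r | P i) normc (F i).
Proof.
by apply: (big_morph _ (@normcM R)); rewrite normc1.
Qed.

Lemma normcX z m : normc (z ^+ m) = normc z ^+ m.
Proof. by elim: m => [|m IH]; rewrite ?expr0 ?normc1 // !exprS normcM IH. Qed.

Lemma normc_distC z1 z2 : normc (z1 - z2) = normc (z2 - z1).
Proof. by rewrite -normcN opprB. Qed.

Lemma ler_norm_Re z : `|complex.Re z| <= normc z.
Proof.
rewrite -(@ler_pXn2r _ 2) ?nnegrE ?normc_ge0 // sqr_normcE.
by rewrite real_normK ?num_real // lerDl sqr_ge0.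
Qed.

(** The left side is the real part of [z1 * z2], in the form in which a coefficient meets a Fourier
    coefficient of the measure. *)
Lemma ler_norm_ReM z1 z2 : `|complex.Re z1 * complex.Re z2 - complex.Im z1 * complex.Im z2|
  <= normc z1 * normc z2.
Proof.
rewrite -normcM.
have -> : complex.Re z1 * complex.Re z2 - complex.Im z1 * complex.Im z2
  = complex.Re (z1 * z2) by case: z1; case: z2.
exact: ler_norm_Re.
Qed.

Lemma normc_le_ReIm z : normc z <= `|complex.Re z| + `|complex.Im z|.
Proof.
rewrite -(@ler_pXn2r _ 2) ?nnegrE ?normc_ge0 ?addr_ge0 // sqr_normcE.
rewrite sqrrD !real_normK ?num_real // addrAC lerDl.
by rewrite mulrn_wge0 // mulr_ge0.
Qed.

End complex_norm.

Section expi.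
Variable R : realType.
Implicit Types (x y t : R).

Definition expi x : R[i] := (cos (2 * pi * x) +i* sin (2 * pi * x))%C.

Lemma expi0 : expi 0 = 1.
Proof. by rewrite /expi mulr0 cos0 sin0. Qed.

Lemma expiD x y : expi (x + y) = expi x * expi y.
Proof.
rewrite /expi mulrDr cosD sinD; simpc; congr (_ +i* _)%C.
by ring.
Qed.

Lemma normc_expi x : normc (expi x) = 1.
Proof. by rewrite /normc /= cos2Dsin2 sqrtr1. Qed.

Lemma expi_sum (I : Type) (r : seq I) (P : pred I) (F : I -> R) :
  expi (\sum_(i <- r | P i) F i) = \prod_(i <- r | P i) expi (F i).
Proof. exact: (big_morph _ expiD expi0). Qed.

Lemma expiMn x (m : nat) : expi (m%:R * x) = expi x ^+ m.
Proof.
elim: m => [|m IH]; first by rewrite mul0r expi0.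
by rewrite -natr1 mulrDl mul1r expiD IH exprSr.
Qed.

Lemma expi1 : expi 1 = 1.
Proof.
by rewrite /expi mulr1 mulr_natl cos2pi sin2pi.
Qed.

Lemma expi_nat (m : nat) : expi m%:R = 1.
Proof. by rewrite -[m%:R]mulr1 expiMn expi1 expr1n. Qed.

Lemma expiN_nat (m : nat) : expi (- m%:R) = 1.
Proof. by have := expiD (- m%:R) m%:R; rewrite addNr expi0 expi_nat mulr1. Qed.

Lemma expi_int (m : int) : expi m%:~R = 1.
Proof.
case: m => m; first exact: expi_nat.
by rewrite NegzE rmorphN /= expiN_nat.
Qed.

Lemma normc_expiB1 t : normc (expi t - 1) = 2 * `|sin (pi * t)|.
Proof.
have h : 2 * pi * t = (pi * t) *+ 2 by rewrite mulr2n; ring.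
apply/eqP; rewrite -(@eqrXn2 _ 2) ?normc_ge0 ?mulr_ge0 //.
rewrite sqr_normcE /= h cos_mulr2n sin_mulr2n oppr0 addr0 exprMn real_normK ?num_real //.
have := cos2sin2 (pi * t); move: (cos _) (sin _) => c s hcs; apply/eqP.
transitivity ((2 * c ^+ 2 - 2) ^+ 2 + 4 * c ^+ 2 * s ^+ 2); first by ring.
by rewrite hcs; ring.
Qed.

Lemma MVT_derive (f df : R -> R) a b : a < b ->
  (forall z : R, is_derive z (1 : R) f (df z)) ->
  exists c : R, f b - f a = df c * (b - a).
Proof.
move=> ab hf.
have cf : {within `[a, b], continuous f}.
  apply/continuous_subspaceT => z.
  by apply/differentiable_continuous/derivable1_diffP; case: (hf z).
by have [c _ hc] := MVT ab (fun z _ => hf z) cf; exists c.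
Qed.

Lemma sin_le_id t : 0 <= t -> sin t <= t.
Proof.
rewrite le_eqVlt => /orP[/eqP <-|t0]; first by rewrite sin0.
have [c] := MVT_derive t0 (@is_derive_sin R).
by rewrite sin0 !subr0 => ->; have := cos_le1 c; nra.
Qed.

(** A crude Jordan inequality. Up to [2^-1], the mean value theorem and [cos z >= 1 - z ^+ 2] give
    [sin z >= z / 2]; beyond, [sin] increases up to [pi / 2 < 2], so [sin t >= 1 / 4 >= t / 8]. *)
Lemma sin_ge_eighth t : 0 <= t <= pi / 2 -> t / 8 <= sin t.
Proof.
have MV (f df : R -> R) (x : R) : 0 < x ->
  (forall z : R, is_derive z (1 : R) f (df z)) ->
  exists2 c : R, 0 < c < x & f x - f 0 = df c * x.
  move=> x0 hf.
  have cf : {within `[0, x], continuous f}.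
    apply/continuous_subspaceT => z.
    by apply/differentiable_continuous/derivable1_diffP; case: (hf z).
  have [c cin hc] := MVT x0 (fun z _ => hf z) cf.
  by exists c; rewrite ?hc ?subr0 //; move: cin; rewrite in_itv.
have cosge (z : R) : 0 <= z -> 1 - z ^+ 2 <= cos z.
  rewrite le_eqVlt => /orP[/eqP <-|z0]; first by rewrite cos0 expr0n subr0.
  have [c /andP[c0 cz] h] := MV cos (fun x => - sin x) z z0 (fun _ => is_derive_cos _).
  move: h; rewrite cos0 => h; have := sin_le_id (ltW c0); nra.
have sin1 (z : R) : 0 <= z <= 2^-1 -> z / 2 <= sin z.
  move=> /andP[z0 z1]; move: z0; rewrite le_eqVlt => /orP[/eqP <-|z0].
    by rewrite sin0 mul0r.
  have [c /andP[c0 cz]] := MV sin cos z z0 (fun _ => is_derive_sin _).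
  rewrite sin0 subr0 => ->; have := cosge c (ltW c0); nra.
move=> /andP[t0 tpi]; have p2 := pihalf_lt2 R; have p1 := pihalf_ge1 R.
have [t2|t2] := leP t 2^-1; first by have := sin1 t; rewrite t0 t2 => /(_ isT); lra.
have : sin 2^-1 < sin t by rewrite ltr_sin // in_itv /=; apply/andP; split; lra.
have : 2^-1 / 2 <= sin (2^-1 : R) by apply: sin1; apply/andP; split; lra.
by lra.
Qed.

(** This lower bound on the chord is what makes division by [1 - zeta] after summation by parts
    profitable. *)
Lemma normc_expiB1_ge t : `|t| <= 2^-1 -> `|t| / 2 <= normc (expi t - 1).
Proof.
move=> t2; rewrite normc_expiB1.
have pi2 := pi_ge2 R.
have -> : `|sin (pi * t)| = `|sin (pi * `|t|)|.
  by case: (ler0P t) => // _; rewrite mulrN sinN normrN.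
have : pi * `|t| / 8 <= sin (pi * `|t|).
  by apply: sin_ge_eighth; have ? := normr_ge0 t; apply/andP; split; nra.
have := ler_norm (sin (pi * `|t|)); have := normr_ge0 t; nra.
Qed.

Lemma expi_neq1 t : 0 < t < 1 -> expi t != 1.
Proof.
move=> /andP[t0 t1]; have p0 := pi_gt0 R.
have : 0 < sin (pi * t) by apply: sin_gt0_pi; apply/andP; split; nra.
move=> s0; apply/eqP => e1; have := normc_expiB1 t.
rewrite e1 subrr normc0 gtr0_norm //; lra.
Qed.

Lemma expi_lip x y : normc (expi x - expi y) <= 2 * pi * `|x - y|.
Proof.
have -> : expi x - expi y = expi y * (expi (x - y) - 1).
  by rewrite mulrBr -expiD mulr1; congr (expi _ - _); ring.
rewrite normcM normc_expi mul1r normc_expiB1.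
have p0 := pi_gt0 R.
have sinabs (z : R) : 0 <= z -> `|sin z| <= z.
  move=> z0; rewrite ler_norml sin_le_id // andbT lerNl -sinN.
  have [z1|z1] := leP z 1; last first.
    by have := sin_le1 (- z); lra.
  rewrite sinN; apply: (@le_trans _ _ 0) => //; rewrite oppr_le0.
  by apply: sin_ge0_pi; have ? := pi_ge2 R; apply/andP; split; lra.
rewrite -mulrA ler_pM2l //.
have -> : `|sin (pi * (x - y))| = `|sin (pi * `|x - y|)|.
  by case: (ler0P (x - y)) => // _; rewrite mulrN sinN normrN.
by apply: sinabs; rewrite mulr_ge0 // ltW.
Qed.

(** A geometric sum of [P]-th roots of unity. The shift [c] recentres the frequencies around zero
    and survives only as a phase. *)
Lemma expi_orthogonality (P : nat) (q : int) (c : R) : (0 < P)%N ->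
  \sum_(i < P) expi ((i%:R - c) * (q%:~R / P%:R)) =
  (if (P %| q)%Z then P%:R * expi (- c * (q%:~R / P%:R)) else 0).
Proof.
move=> P0; have P0' : (P%:R : R) != 0 by rewrite pnatr_eq0 -lt0n.
under eq_bigr do rewrite mulrBl addrC -mulNr expiD expiMn.
rewrite -mulr_sumr; case: ifPn => [/dvdzP[a ->]|ndvd].
  rewrite intrM mulfK // expi_int.
  under eq_bigr do rewrite expr1n.
  by rewrite sumr_const card_ord mulrC.
set z := expi (q%:~R / P%:R).
suff z1 : z != 1.
  have : (z - 1) * \sum_(i < P) z ^+ i = 0.
    rewrite -subrX1 -expiMn mulrC divfK // expi_int subrr //.
  by move/eqP; rewrite mulf_eq0 subr_eq0 (negbTE z1) => /eqP ->; rewrite mulr0.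
have -> : z = expi ((q %% P)%Z%:~R / P%:R).
  rewrite /z {1}(divz_eq q P) intrD intrM mulrDl mulfK // expiD expi_int mul1r //.
apply: expi_neq1.
have r0 : (0 <= (q %% P)%Z) by apply: modz_ge0; lia.
have r1 : ((q %% P)%Z < P) by apply: ltz_pmod; lia.
have rn0 : (q %% P)%Z != 0 by apply: contra ndvd => /eqP /dvdz_mod0P.
rewrite ltr_pdivlMr ?ltr_pdivrMr ?ltr0n // mul0r mul1r.
rewrite ltr0z lt_neqAle eq_sym rn0 r0 /= -[P%:R]/(P%:~R) ltr_int //.
Qed.

End expi.

(** * Finite differences and the bump function *)

Section finite_difference.
Variables (R : realType) (eta : R).
Hypothesis eta0 : 0 < eta.

Fixpoint fdiff (m : nat) (f : R -> R) : R -> R :=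
  if m is m'.+1 then fun x => fdiff m' f (x + eta) - fdiff m' f x else f.

Lemma is_derive_fdiff m (f df : R -> R) :
  (forall x : R, is_derive x (1 : R) f (df x)) ->
  forall x : R, is_derive x (1 : R) (fdiff m f) (fdiff m df x).
Proof.
move=> hf; elim: m => [|m IH] x /=; first exact: hf.
apply: is_deriveB.
have sh : is_derive x (1 : R) (fun y : R => y + eta) 1 by exact: is_derive_shift.
have := @is_derive1_comp R (fdiff m f) (fun y : R => y + eta) x _ _ (IH (x + eta)) sh.
by rewrite mulr1.
Qed.

(** Differences commute with differentiation, so the mean value theorem trades one difference for a
    factor [eta] and one derivative; the induction is over all [f]. *)
Lemma fdiff_le m (f : R -> R) (K : R) :
  (forall j (x : R), derivable (derive1n j f) x 1) ->
  (forall x, `|derive1n m f x| <= K) ->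
  forall x, `|fdiff m f x| <= eta ^+ m * K.
Proof.
elim: m f => [|m IH] f sf bf x /=; first by rewrite expr0 mul1r.
have hf (z : R) : is_derive z (1 : R) f (derive1 f z).
  by rewrite derive1E; apply/derivableP; exact: (sf 0%N).
have [|c ->] := @MVT_derive R _ _ x (x + eta) _ (is_derive_fdiff m hf).
  by rewrite ltrDl.
rewrite addrAC subrr add0r normrM (gtr0_norm eta0) mulrC exprS -mulrA ler_pM2l //.
apply: IH => [j z|z]; first by have := sf j.+1 z; rewrite derive1Sn.
by have := bf z; rewrite derive1Sn.
Qed.

(** [fdiff m f x] samples [f] at [x, x + eta, ..., x + m * eta] only; either condition puts all
    these points on one side of the support. *)
Lemma fdiff_eq0 m (f : R -> R) (b x : R) :
  (forall y, f y != 0 -> - b <= y <= b) ->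
  b < x \/ x + m%:R * eta < - b -> fdiff m f x = 0.
Proof.
move=> fb; elim: m x => [|m IH] x h /=.
  apply/eqP/negPn/negP => /fb /andP[h1 h2].
  by case: h => h; lra.
rewrite !IH ?subrr //; move: h eta0; rewrite -natr1 => -[h|h] e0.
- by left; lra.
- by right; lra.
- by left; lra.
- by right; lra.
Qed.

End finite_difference.

(** Summation by parts; vanishing at both ends removes the boundary terms. Each use trades a
    difference for a factor [1 - z]. *)
Lemma sum_shift_mul (R : rcfType) (g : nat -> R[i]) (z : R[i]) n :
  g 0%N = 0 -> g n = 0 ->
  z * \sum_(i < n) (g i.+1 - g i) * z ^+ i = (1 - z) * \sum_(i < n) g i * z ^+ i.
Proof.
move=> g0 gn.
have -> : \sum_(i < n) (g i.+1 - g i) * z ^+ i =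
  \sum_(i < n) g i.+1 * z ^+ i - \sum_(i < n) g i * z ^+ i.
  by rewrite -sumrB; apply: eq_bigr => i _; rewrite mulrBl.
rewrite mulrBr mulrBl mul1r; congr (_ - _).
have : \sum_(i < n.+1) g i * z ^+ i = \sum_(i < n) g i * z ^+ i.
  by rewrite big_ord_recr /= gn mul0r addr0.
rewrite big_ord_recl /= g0 mul0r add0r => <-; rewrite mulr_sumr.
by apply: eq_bigr => i _; rewrite exprS mulrCA.
Qed.

Section bump.
Variables (R : realType) (w : R -> R).
Hypothesis wb : bump_fun w.

Lemma bump_ge0 x : 0 <= w x.
Proof. by case: wb => h _ _ _; have /andP[] := h x. Qed.

Lemma bump_le1 x : w x <= 1.
Proof. by case: wb => h _ _ _; have /andP[] := h x. Qed.

Lemma bump_support x : w x != 0 -> - 2 <= x <= 2.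
Proof. by case: wb => _ h _ _; exact: h. Qed.

Lemma bump_eq0 x : 2 < `|x| -> w x = 0.
Proof.
move=> x2; apply/eqP/negPn/negP => /bump_support; rewrite -ler_norml => h.
by move: x2; rewrite ltNge h.
Qed.

Lemma bump_derivable m (x : R) : derivable (derive1n m w) x 1.
Proof. by case: wb => _ _ _; exact. Qed.

Lemma bump_derivative_continuous m : continuous (derive1n m w).
Proof.
by move=> x; apply/differentiable_continuous/derivable1_diffP/bump_derivable.
Qed.

(** The strict inequality is an open condition, so the preceding derivative vanishes on a
    neighbourhood of [x], not only at [x]. *)
Lemma bump_derivative_eq0 m x : 2 < `|x| -> derive1n m w x = 0.
Proof.
elim: m x => [|m IH] x x2; first by rewrite derive1n0 bump_eq0.
rewrite derive1nS derive1E.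
rewrite (@near_eq_derive _ _ _ _ (cst 0)); first by rewrite derive_cst.
near=> z; rewrite /= IH //; near: z.
have : {for x, continuous (fun z : R => `|z|)} by exact: norm_continuous.
move=> /(_ [set u | 2 < u]) /=; apply.
exact: lt_nbhsr.
Unshelve. all: by end_near.
Qed.

Lemma bump_derivative_bounded m : exists2 K : R, 0 < K & forall x, `|derive1n m w x| <= K.
Proof.
have cn : {within `[(-2 : R), 2], continuous (fun x => `|derive1n m w x|)}.
  apply/continuous_subspaceT => x.
  by apply: continuous_comp; [exact: bump_derivative_continuous|exact: norm_continuous].
have [|c _ hc] := EVT_max _ cn; first by lra.
exists (`|derive1n m w c| + 1); first by rewrite ltr_wpDl.
move=> x; have [x2|x2] := leP `|x| 2.
  apply: le_trans (hc x _) _; first by rewrite in_itv /= -ler_norml.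
  by rewrite lerDl.
by rewrite bump_derivative_eq0 // normr0 addr_ge0.
Qed.

Lemma bump_continuous : continuous w.
Proof. exact: (@bump_derivative_continuous 0). Qed.

Lemma bump_lipschitz : exists2 K : R, 0 < K & forall x y, `|w x - w y| <= K * `|x - y|.
Proof.
have [K K0 hK] := bump_derivative_bounded 1; exists K => // x y.
have hw (z : R) : is_derive z (1 : R) w (derive1 w z).
  by rewrite derive1E; apply/derivableP; exact: (@bump_derivable 0).
have L (a b : R) : a < b -> `|w b - w a| <= K * `|b - a|.
  move=> ab; have [c ->] := MVT_derive ab hw.
  by rewrite normrM ler_wpM2r //; exact: hK.
case: (ltgtP x y) => [xy|xy|->]; last by rewrite !subrr normr0 mulr0.
- by rewrite distrC [`|x - y|]distrC; exact: L.
- exact: L.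
Qed.

End bump.

(** * Trigonometric interpolation of periodizations *)

Lemma sum_inv_sqrS (R : realType) (L : nat) :
  \sum_(i < L.+1.*2.+1) ((i%:R - L.+1%:R : R) ^+ 2)^-1 =
  \sum_(i < L.*2.+1) ((i%:R - L%:R : R) ^+ 2)^-1 + 2 * (L.+1%:R ^+ 2)^-1.
Proof.
rewrite doubleS big_ord_recl big_ord_recr /=.
under eq_bigr => i _.
  rewrite /bump /= /widen_ord /= add1n.
  rewrite (_ : (i.+1%:R - L.+1%:R : R) = i%:R - L%:R); last by rewrite -!natr1; ring.
  over.
rewrite /bump /= add1n sub0r sqrrN.
have -> : (L.*2.+2%:R - L.+1%:R : R) = L.+1%:R.
  by rewrite -addnn -!natr1 natrD; ring.
by rewrite mulr_natl mulr2n addrCA.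
Qed.

(** The middle term is [0^-1 = 0], so this is twice a partial sum of [1 / l^2]. The induction
    carries the sharper bound [4 - 2 / l.+1%:R], which absorbs each new pair of terms by
    telescoping. *)
Lemma sum_inv_sqr_le4 (R : realType) (L : nat) :
  \sum_(i < L.*2.+1) ((i%:R - L%:R : R) ^+ 2)^-1 <= 4.
Proof.
have S0 : \sum_(i < 0.*2.+1) ((i%:R - 0%:R : R) ^+ 2)^-1 = 0.
  by rewrite big_ord_recl big_ord0 /= subrr expr0n /= invr0 addr0.
suff H l : \sum_(i < l.+1.*2.+1) ((i%:R - l.+1%:R : R) ^+ 2)^-1 <= 4 - 2 / l.+1%:R.
  case: L => [|L]; first by rewrite S0.
  by apply: le_trans (H L) _; rewrite gerBl divr_ge0.
elim: l => [|l IH]; first by rewrite sum_inv_sqrS S0 expr1n; lra.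
rewrite sum_inv_sqrS.
have x0 : (0 : R) < l.+1%:R by rewrite ltr0n.
suff H : 2 * (l.+2%:R ^+ 2 : R)^-1 <= 2 / l.+1%:R - 2 / l.+2%:R.
  move: IH H; set S := \sum_(i < _) _.
  by move: (2 / l.+1%:R) (2 / l.+2%:R) (_ ^- 2) => a b c; lra.
rewrite -[l.+2%:R]natr1; move: (l.+1%:R) x0 => x x0.
have -> : 2 / x - 2 / (x + 1) = 2 / (x * (x + 1)) by field; rewrite !gt_eqF //; lra.
rewrite ler_pM2l // lef_pV2 ?posrE; nra.
Qed.

Section interpolation.
Variables (R : realType) (w : R -> R).
Hypothesis wb : bump_fun w.
Variables (D : R) (L R0 M : nat).
Hypothesis D0 : 0 < D.
Let P := L.*2.+1.
Let h : R := P%:R^-1.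
Let eta := h / D.
Hypothesis R0_large : 2 + M%:R * eta < R0%:R * eta.

Let n0 := R0.*2.+1.

Let P0 : (0 : R) < P%:R. Proof. by rewrite ltr0n. Qed.
Let PE : (P%:R : R) = L%:R + L%:R + 1.
Proof. by rewrite /P -addnn -natr1 natrD. Qed.
Let h0 : 0 < h. Proof. by rewrite invr_gt0. Qed.
Let eta0 : 0 < eta. Proof. by rewrite divr_gt0. Qed.

(** A Riemann sum of step [h] for the Fourier coefficient, at frequency [i - L], of the
    1-periodization of [w (u / D)]; [P] is odd so that the frequencies are symmetric about zero. The
    samples are not folded modulo [P]. By [R0_large] the window overshoots the support by [M] steps,
    so the first [M] summations by parts have no boundary terms. *)
Definition dft_coef (i : 'I_P) : R[i] :=
  (h%:C)%C * \sum_(r < n0) ((w ((r%:R - R0%:R) * eta))%:C)%C *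
    expi (- ((i%:R - L%:R) * ((r%:R - R0%:R) * h))).

Definition trig_interp (u : R) : R[i] :=
  \sum_(i < P) dft_coef i * expi ((i%:R - L%:R) * u).

(** The shifts are cut off at [B] to keep the sum finite; [B] is later large enough that the omitted
    terms vanish wherever the function is used. *)
Definition periodization (B : nat) (u : R) : R :=
  \sum_(a < B.*2.+1) w ((u - (a%:R - B%:R)) / D).

Lemma dft_coef_le i : normc (dft_coef i) <= h * n0%:R.
Proof.
rewrite normcM normc_real gtr0_norm // ler_pM2l //.
apply: le_trans (le_normc_sum _ _ _) _.
have -> : (n0%:R : R) = \sum_(r < n0) 1 by rewrite sumr_const card_ord.
apply: ler_sum => r _; rewrite normcM normc_real normc_expi mulr1.
by rewrite ger0_norm ?bump_ge0 ?bump_le1.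
Qed.

(** [M] summations by parts multiply the sum by [(1 - zeta) ^+ M], of modulus at least
    [(|z| * h / 2) ^+ M], whereas [M]-th differences of [w] are at most [eta ^+ M * K]. As
    [eta = h / D], the quotient is a power of [D * |z|], free of [h]. *)
Lemma dft_coef_decay i (K : R) : (forall x, `|derive1n M w x| <= K) ->
  normc (dft_coef i) * (D * `|i%:R - L%:R|) ^+ M <= h * n0%:R * (2 ^+ M * K).
Proof.
move=> hK; set z := i%:R - L%:R.
pose zeta := expi (- (z * h)).
pose S (m : nat) := \sum_(r < n0)
  ((fdiff eta m w ((r%:R - R0%:R) * eta))%:C)%C * zeta ^+ r.
have cS : normc (dft_coef i) = h * normc (S 0%N).
  rewrite normcM normc_real gtr0_norm //; congr (_ * _).
  have -> : S 0%N = expi (- (z * (R0%:R * h))) * \sum_(r < n0)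
     ((w ((r%:R - R0%:R) * eta))%:C)%C * expi (- (z * ((r%:R - R0%:R) * h))).
    rewrite mulr_sumr; apply: eq_bigr => r _ /=.
    rewrite [RHS]mulrCA; congr (_ * _); rewrite -expiD /zeta -expiMn.
    by congr expi; ring.
  by rewrite normcM normc_expi mul1r.
have SS (m : nat) : (m < M)%N -> zeta * S m.+1 = (1 - zeta) * S m.
  move=> mM.
  have supp x : 2 < x \/ x + m%:R * eta < - 2 -> fdiff eta m w x = 0.
    by apply: fdiff_eq0 => //; exact: bump_support.
  rewrite /S -(@sum_shift_mul _ (fun r => ((fdiff eta m w ((r%:R - R0%:R) * eta))%:C)%C)) //.
  - congr (_ * _); apply: eq_bigr => r _; congr (_ * _) => /=.
    rewrite -rmorphB /=; congr (_%:C)%C; congr (fdiff _ _ _ _ - _).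
    by rewrite -natr1; ring.
  - rewrite supp //; right; rewrite sub0r mulNr.
    suff : m%:R * eta <= M%:R * eta.
      by move: R0_large; move: (m%:R * eta) (M%:R * eta) (R0%:R * eta) => a b c; lra.
    by rewrite ler_pM2r // ler_nat ltnW.
  - rewrite supp //; left.
    have -> : (n0%:R : R) = R0%:R + R0%:R + 1 by rewrite /n0 -addnn -natr1 natrD.
    have : 0 <= M%:R * eta by rewrite mulr_ge0 // ltW.
    have -> : (R0%:R + R0%:R + 1 - R0%:R) * eta = R0%:R * eta + eta by ring.
    move: R0_large eta0; move: (M%:R * eta) (R0%:R * eta) eta => b c e; lra.
have SM (m : nat) : (m <= M)%N -> normc (S m) = normc (1 - zeta) ^+ m * normc (S 0%N).
  elim: m => [|m IH] mM; first by rewrite mul1r.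
  rewrite exprS -mulrA -IH ?(ltnW mM) // -normcM -SS // normcM normc_expi mul1r //.
have S_le : normc (S M) <= n0%:R * (eta ^+ M * K).
  apply: le_trans (le_normc_sum _ _ _) _.
  have -> : (n0%:R : R) = \sum_(r < n0) 1 by rewrite sumr_const card_ord.
  rewrite mulr_suml.
  apply: ler_sum => r _; rewrite normcM normc_real normcX normc_expi expr1n mulr1 mul1r.
  by apply: fdiff_le => // j x; exact: bump_derivable.
(* The chord bound applies because [|z| <= L < P / 2], that is, [|z| * h <= 2^-1]. *)
have chord : `|z| * h / 2 <= normc (1 - zeta).
  have zh : `|- (z * h)| = `|z| * h by rewrite normrN normrM (gtr0_norm h0).
  rewrite normc_distC -zh; apply: normc_expiB1_ge; rewrite zh.
  rewrite /h ler_pdivrMr //.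
  have : `|z| <= L%:R.
    rewrite /z ler_norml; have := ltn_ord i; rewrite /P -ltnS => iP.
    apply/andP; split; first by rewrite lerBrDr addrC subrr ler0n.
    by rewrite lerBlDr -natrD ler_nat addnn -ltnS.
  by move=> /le_trans; apply; rewrite PE; lra.
have zh0 : 0 <= `|z| * h / 2 by rewrite !mulr_ge0 // ltW.
have -> : (D * `|z|) ^+ M = (`|z| * h / 2) ^+ M * (2 / eta) ^+ M.
  by rewrite -exprMn; congr (_ ^+ _); rewrite /eta; field; rewrite !gt_eqF.
have e2 : (0 : R) <= (2 / eta) ^+ M by rewrite exprn_ge0 // divr_ge0 // ltW.
rewrite [leLHS]mulrA.
apply: (@le_trans _ _ (normc (dft_coef i) * normc (1 - zeta) ^+ M * (2 / eta) ^+ M)).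
  rewrite ler_wpM2r // ler_wpM2l ?normc_ge0 //.
  by apply: lerXn2r; rewrite ?nnegrE ?normc_ge0.
have -> : normc (dft_coef i) * normc (1 - zeta) ^+ M = h * normc (S M).
  by rewrite cS (SM M) // -[LHS]mulrA; congr (_ * _); exact: mulrC.
rewrite -[leLHS]mulrA -[leRHS]mulrA ler_pM2l //.
apply: le_trans (ler_wpM2r e2 S_le) _.
rewrite le_eqVlt; apply/orP; left; apply/eqP.
have ee : eta * (2 / eta) = 2 by rewrite mulrCA divff ?mulr1 // gt_eqF.
by rewrite -[LHS]mulrA; congr (_ * _); rewrite mulrAC -exprMn ee.
Qed.

(** At a grid point, orthogonality selects the samples with [r - R0] congruent to [s] modulo [P]. If
    [s - (r - R0) = t * P], the sample is the value of [w] contributed by the shift [t]; the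
    hypothesis keeps [t] within [B] whenever that value is non-zero. *)
Lemma trig_interp_grid (s : int) (B : nat) :
  `|s%:~R * h| + 2 * D <= B%:R ->
  trig_interp (s%:~R * h) = ((periodization B (s%:~R * h))%:C)%C.
Proof.
move=> hB.
have Pn0 : (P%:R : R) != 0 by rewrite gt_eqF.
pose q (r : nat) : int := s - (r%:Z - R0%:Z).
have qE r : ((q r)%:~R : R) = s%:~R - (r%:R - R0%:R).
  by rewrite /q !rmorphB /=.
pose W (r : nat) := w ((r%:R - R0%:R) * eta).
have -> : trig_interp (s%:~R * h) = ((\sum_(r < n0) if (P %| q r)%Z then W r else 0)%:C)%C.
  have cE (i : 'I_P) : dft_coef i * expi ((i%:R - L%:R) * (s%:~R * h)) =
      (h%:C)%C * \sum_(r < n0) ((W r)%:C)%C * expi ((i%:R - L%:R) * ((q r)%:~R / P%:R)).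
    rewrite /dft_coef -mulrA mulr_suml; congr (_ * _); apply: eq_bigr => r _.
    by rewrite -mulrA -expiD; congr (_ * expi _); rewrite qE /h; ring.
  rewrite rmorph_sum /trig_interp (eq_bigr _ (fun i _ => cE i)) -mulr_sumr.
  rewrite exchange_big mulr_sumr; apply: eq_bigr => r _.
  rewrite -mulr_sumr expi_orthogonality //.
  case: ifPn => [/dvdzP[a qa]|_]; last by rewrite !mulr0.
  rewrite qa intrM mulfK // mulNr (_ : - (L%:R * a%:~R) = (- (L%:Z * a))%:~R); last first.
    by rewrite rmorphN rmorphM.
  rewrite expi_int mulr1 mulrCA.
  rewrite (_ : (P%:R : R[i]) = (P%:R%:C)%C); last by rewrite rmorph_nat.
  by rewrite -rmorphM /= /h mulVf // rmorph1 mulr1.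
congr (_%:C)%C.
(* Samples and shifts are matched: each [r] has at most one [a] and each [a] at most one [r], and
   whatever stays unmatched contributes zero. *)
transitivity (\sum_(r < n0) \sum_(a < B.*2.+1)
   (if q r == (a%:Z - B%:Z) * P%:Z then W r else 0)).
  apply: eq_bigr => r _; case: ifPn => [/dvdzP[t qt]|ndvd]; last first.
    rewrite big1 // => a _; case: eqP => // qa; move: ndvd; rewrite qa.
    by rewrite dvdz_mull.
  have [W0|Wn0] := eqVneq (W r) 0; first by rewrite W0 big1 // => a _; case: ifP.
  have : `|t%:~R : R| <= B%:R.
    apply: le_trans hB.
    have -> : (t%:~R : R) = s%:~R * h - (r%:R - R0%:R) * h.
      rewrite -mulrBl -qE qt intrM /h mulfK //.
    apply: le_trans (ler_normB _ _) _; rewrite lerD2l.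
    have := bump_support wb Wn0; rewrite -ler_norml.
    rewrite /eta mulrA normrM (gtr0_norm (_ : 0 < D^-1)) ?invr_gt0 //.
    by rewrite ler_pdivrMr.
  rewrite -[B%:R]/(B%:~R) -intr_norm ler_int => tB.
  have tb : (absz (t + B%:Z)%R < B.*2.+1)%N by lia.
  rewrite (bigD1 (Ordinal tb)) //= qt.
  have -> : (absz (t + B%:Z))%:Z - B%:Z = t by lia.
  rewrite eqxx big1 ?addr0 // => a an; case: eqP => // /eqP.
  rewrite (inj_eq (mulIf _)) // => /eqP ta.
  by case/eqP: an; apply/val_inj => /=; lia.
rewrite exchange_big /=; apply: eq_bigr => a _.
set t := a%:Z - B%:Z.
have -> : (s%:~R * h - (a%:R - B%:R)) / D = ((s - t * P%:Z)%:~R) * eta.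
  have -> : ((s - t * P%:Z)%:~R : R) = s%:~R - (a%:R - B%:R) * P%:R.
    by rewrite rmorphB rmorphM /= /t rmorphB.
  by rewrite /eta mulrA; congr (_ / D); rewrite mulrBl mulfK.
set v := s - t * P%:Z.
have [vR|vR] := leP `|v| R0%:Z; last first.
  rewrite big1 => [|r _].
    rewrite bump_eq0 // normrM (gtr0_norm eta0).
    have : (R0%:R : R) <= `|v%:~R| by rewrite -[R0%:R]/(R0%:~R) -intr_norm ler_int ltW.
    rewrite -(ler_pM2r eta0); have : 0 <= M%:R * eta by rewrite mulr_ge0 // ltW.
    move: R0_large; move: (M%:R * eta) (R0%:R * eta) (`|v%:~R| * eta) => a' b c; lra.
  case: eqP => // qr; exfalso; have := ltn_ord r; rewrite /n0 => rR.
  move: vR; rewrite /v -qr /q opprB addrCA subrr addr0.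
  move: (nat_of_ord r) rR => r' rR; case: (ler0P (r'%:Z - R0%:Z)); lia.
have vb : (absz (v + R0%:Z)%R < n0)%N by rewrite /n0; lia.
rewrite (bigD1 (Ordinal vb)) //= big1 ?addr0.
  rewrite /q ifT; last by apply/eqP; rewrite /v; lia.
  rewrite /W; congr (w (_ * _)).
  rewrite -[_%:R]/(((absz (v + R0%:Z))%:Z)%:~R) -[R0%:R]/(R0%:~R) -rmorphB /=; congr (_%:~R).
  by lia.
move=> r rn; case: eqP => // qr; case/eqP: rn; apply/val_inj => /=.
by move: qr; rewrite /q /v; lia.
Qed.

End interpolation.

(** A bound free of [L], so the grid can be refined without loss. The constant is [2 * pi], the
    Lipschitz constant of [expi], times the bound 4 on the sum of inverse squares. *)
Lemma trig_interp_lip (R : realType) (w : R -> R) (D A : R) (L R0 : nat) (u v : R) :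
  (forall i : 'I_(L.*2.+1), normc (dft_coef w D R0 i) * `|i%:R - L%:R|
     <= A * ((i%:R - L%:R) ^+ 2)^-1) ->
  0 <= A ->
  normc (trig_interp w D L R0 u - trig_interp w D L R0 v) <= 8 * pi * A * `|u - v|.
Proof.
move=> hc A0; rewrite /trig_interp -sumrB.
apply: le_trans (le_normc_sum _ _ _) _.
have p0 : (0 : R) <= 2 * pi by rewrite mulr_ge0 // pi_ge0.
apply: (@le_trans _ _ (\sum_(i < L.*2.+1)
    (A * ((i%:R - L%:R) ^+ 2)^-1) * (2 * pi * `|u - v|))).
  apply: ler_sum => i _; rewrite -mulrBr normcM.
  apply: (@le_trans _ _ (normc (dft_coef w D R0 i) * (2 * pi * `|(i%:R - L%:R) * (u - v)|))).
    by rewrite ler_wpM2l ?normc_ge0 // mulrBr; exact: expi_lip.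
  rewrite normrM.
  have -> : normc (dft_coef w D R0 i) * (2 * pi * (`|i%:R - L%:R| * `|u - v|)) =
    normc (dft_coef w D R0 i) * `|i%:R - L%:R| * (2 * pi * `|u - v|) by ring.
  by rewrite ler_wpM2r // mulr_ge0.
rewrite -mulr_suml -mulr_sumr.
have := sum_inv_sqr_le4 R L; set S := \sum_(i < _) _ => S4.
have -> : 8 * pi * A * `|u - v| = A * 4 * (2 * pi * `|u - v|) by ring.
by rewrite ler_wpM2r ?mulr_ge0 ?pi_ge0 // ler_wpM2l.
Qed.

Lemma periodization_lip (R : realType) (w : R -> R) (D K : R) (B : nat) (u v : R) :
  0 < D -> (forall x y, `|w x - w y| <= K * `|x - y|) ->
  `|periodization w D B u - periodization w D B v| <= B.*2.+1%:R * (K / D) * `|u - v|.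
Proof.
move=> D0 hK; rewrite /periodization -sumrB.
apply: le_trans (ler_norm_sum _ _ _) _.
have -> : (B.*2.+1%:R : R) = \sum_(a < B.*2.+1) 1 by rewrite sumr_const card_ord.
rewrite -mulrA mulr_suml; apply: ler_sum => a _; rewrite mul1r.
apply: le_trans (hK _ _) _.
rewrite -mulrBl normrM (gtr0_norm (_ : 0 < D^-1)) ?invr_gt0 //.
rewrite le_eqVlt; apply/orP; left; apply/eqP.
by rewrite -mulrA [D^-1 * _]mulrC; congr (_ * (`| _ | * _)); ring.
Qed.

(* [K] is uniform in [D]: the true Fourier coefficients of the periodization have
   modulus [D |w^(D m)|], and the interpolation coefficients satisfy the same bounds. *)
Lemma periodization_approx (R : realType) (w : R -> R) (M : nat) :
  bump_fun w -> (3 <= M)%N ->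
  exists2 K : R, 0 < K & forall (D y delta U : R) (B : nat),
    0 < D -> 0 < delta -> U + `|y| + 2 * D + 1 <= B%:R ->
    exists L0 : nat, forall L, (L0 <= L)%N -> exists c : 'I_(L.*2.+1) -> R[i],
      [/\ forall i, normc (c i) <= K * D,
          forall i, normc (c i) * (D * `|i%:R - L%:R|) ^+ M <= K * D &
          forall u, `|u| <= U ->
            normc (((\sum_(a < B.*2.+1) w ((u - (a%:R - B%:R) - y) / D))%:C)%C
              - \sum_i c i * expi ((i%:R - L%:R) * u)) <= delta].
Proof.
move=> wb M3.
have [KM KM0 hKM] := bump_derivative_bounded wb M.
have [K1 K10 hK1] := bump_lipschitz wb.
(* The factor 5 is that of [h * n0 <= 5 * D], proved below as [hn0]; the two summands serve the
   trivial bound and the decay. *)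
pose K := 5 * (1 + 2 ^+ M * KM).
have K0 : 0 < K by rewrite mulr_gt0 // addr_gt0 // mulr_gt0 // exprn_gt0.
exists K => // D y delta U B D0 delta0 hB.
pose A := K * D / D ^+ M.
have A0 : 0 < A by apply: divr_gt0; [exact: mulr_gt0|exact: exprn_gt0].
(* A joint Lipschitz constant for the periodization and its interpolant. It does not involve [L], so
   a fine enough grid brings the error below [delta]. *)
pose E := B.*2.+1%:R * (K1 / D) + 8 * pi * A.
have E0 : 0 < E.
  apply: addr_gt0; last by rewrite mulr_gt0 // mulr_gt0 // pi_gt0.
  by rewrite mulr_gt0 ?ltr0n // divr_gt0.
have m50 : (0 : R) < (2 * M + 5)%:R by rewrite ltr0n addnS.
have [h1 h10 [h1D [h1E h11]]] : exists2 h1 : R, 0 < h1 &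
    (2 * M + 5)%:R * h1 <= D /\ E * h1 <= delta /\ h1 <= 1.
  exists (Num.min (D / (2 * M + 5)%:R) (Num.min (delta / E) 1)).
    by rewrite !lt_min ltr01 !divr_gt0.
  split; last split; last by rewrite !ge_min lexx !orbT.
  - by rewrite mulrC -ler_pdivlMr // ge_min lexx.
  - by rewrite mulrC -ler_pdivlMr // !ge_min lexx !orbT.
exists (Num.bound h1^-1) => L; rewrite -(ler_nat R) => L0L.
have {}L0L : h1^-1 <= L%:R.
  by apply: le_trans L0L; apply/ltW/archi_boundP; rewrite invr_ge0 ltW.
pose h : R := (L.*2.+1%:R)^-1.
have P0 : (0 : R) < L.*2.+1%:R by rewrite ltr0n.
have h0 : 0 < h by rewrite invr_gt0.
have hh1 : h <= h1.
  rewrite /h -[leRHS]invrK lef_pV2 ?posrE ?invr_gt0 //.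
  by apply: le_trans L0L _; rewrite ler_nat -addnn leqW // leq_addr.
pose eta := h / D.
have eta0 : 0 < eta by rewrite divr_gt0.
(* The window then has total length at most [4 * D + (2 * M + 3) * h], and the choice of [h1] keeps
   the second term below [D]. *)
pose R0 := ((Num.truncn (2 / eta)) + M + 1)%N.
have e20 : 0 <= 2 / eta by rewrite divr_ge0 // ltW.
have /andP[tr1 tr2] := truncn_itv e20.
have R0_large : 2 + M%:R * eta < R0%:R * eta.
  have -> : R0%:R * eta = (Num.truncn (2 / eta)).+1%:R * eta + M%:R * eta.
    by rewrite /R0 !natrD -natr1; ring.
  by rewrite ltrD2r -ltr_pdivrMr.
have hn0 : h * R0.*2.+1%:R <= 5 * D.
  have -> : (R0.*2.+1%:R : R) = 2 * (Num.truncn (2 / eta))%:R + (2 * M%:R + 3).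
    by rewrite /R0 -addnn -natr1 !natrD; ring.
  have t1 : h * (Num.truncn (2 / eta))%:R <= 2 * D.
    have -> : 2 * D = h * (2 / eta).
      by rewrite /eta; field; rewrite !gt_eqF.
    by rewrite ler_pM2l.
  have : (2 * M + 5)%:R * h <= D by apply: le_trans h1D; rewrite ler_wpM2l.
  have -> : ((2 * M + 5)%:R : R) = 2 * M%:R + 5 by rewrite natrD natrM.
  move: t1 h0; move: (Num.truncn _)%:R (M%:R : R) => t m t1 h0' h2.
  have -> : h * (2 * t + (2 * m + 3)) = 2 * (h * t) + (2 * m + 5) * h - 2 * h by ring.
  lra.
have c1 (i : 'I_(L.*2.+1)) : normc (dft_coef w D R0 i) <= K * D.
  apply: le_trans (dft_coef_le wb D R0 i) _; apply: le_trans hn0 _.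
  rewrite ler_pM2r // /K -[leLHS]mulr1 ler_pM2l // lerDl.
  by rewrite mulr_ge0 ?exprn_ge0 // ltW.
have c2 (i : 'I_(L.*2.+1)) : normc (dft_coef w D R0 i) * (D * `|i%:R - L%:R|) ^+ M <= K * D.
  apply: le_trans (dft_coef_decay wb D0 R0_large i hKM) _.
  apply: (@le_trans _ _ (5 * D * (2 ^+ M * KM))).
    by rewrite ler_wpM2r // mulr_ge0 ?exprn_ge0 // ltW.
  rewrite /K mulrAC ler_pM2r // ler_pM2l // lerDr //.
(* Translating by [y] multiplies each coefficient by a phase, so the bounds are uniform in [y]. *)
exists (fun i => dft_coef w D R0 i * expi (- ((i%:R - L%:R) * y))); split.
- by move=> i; rewrite normcM normc_expi mulr1.
- by move=> i; rewrite normcM normc_expi mulr1.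
move=> u uU.
have -> : \sum_(i < L.*2.+1) dft_coef w D R0 i * expi (- ((i%:R - L%:R) * y)) *
    expi ((i%:R - L%:R) * u) = trig_interp w D L R0 (u - y).
  rewrite /trig_interp; apply: eq_bigr => i _.
  by rewrite -mulrA -expiD; congr (_ * expi _); ring.
have -> : \sum_(a < B.*2.+1) w ((u - (a%:R - B%:R) - y) / D) = periodization w D B (u - y).
  by rewrite /periodization; apply: eq_bigr => a _; congr (w (_ / _)); ring.
set v := u - y.
have vU : `|v| <= U + `|y| by apply: le_trans (ler_normB _ _) _; rewrite lerD2r.
pose s := Num.floor (v * L.*2.+1%:R).
have /andP[s1 s2] := real_floor_itv (num_real (v * L.*2.+1%:R)).
pose v' := s%:~R * h.
have vv' : `|v - v'| <= h.
  have vE : v = v * L.*2.+1%:R * h by rewrite /h mulfK // gt_eqF.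
  rewrite {1}vE /v' -mulrBl normrM (gtr0_norm h0) -[leRHS]mul1r ler_pM2r //.
  rewrite ler_norml; move: s1 s2; rewrite -/s intrD; lra.
(* Here [3 <= M] enters: a non-zero integer [i - L] has modulus at least 1, so the decay of order
   [M] implies cubic decay, which remains summable after differentiation. *)
have ci (i : 'I_(L.*2.+1)) :
    normc (dft_coef w D R0 i) * `|i%:R - L%:R| <= A * ((i%:R - L%:R) ^+ 2)^-1.
  have [z0|z0] := eqVneq (i%:R - L%:R : R) 0.
    by rewrite z0 normr0 mulr0 expr0n /= invr0 mulr0.
  rewrite ler_pdivlMr ?exprn_even_gt0 // -[_ ^+ 2]real_normK ?num_real //.
  rewrite -mulrA -exprS ler_pdivlMr ?exprn_gt0 //.
  apply: le_trans (c2 i); rewrite exprMn [D ^+ M * _]mulrC [leRHS]mulrA ler_pM2r ?exprn_gt0 //.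
  rewrite ler_wpM2l ?normc_ge0 // ler_weXn2l //.
  have -> : i%:R - L%:R = (i%:Z - L%:Z)%:~R :> R by rewrite rmorphB.
  rewrite -intr_norm -[1]/(1%:~R) ler_int.
  have : (i%:Z - L%:Z) != 0.
    by apply: contra z0 => /eqP e; rewrite -[i%:R]/(i%:~R) -[L%:R]/(L%:~R) -rmorphB /= e.
  by rewrite -normr_gt0 gtz0_ge1.
have g0 : trig_interp w D L R0 v' = ((periodization w D B v')%:C)%C.
  apply: (trig_interp_grid wb D0 R0_large).
  apply: le_trans hB; rewrite -[leRHS]addrAC lerD2r.
  have -> : s%:~R / L.*2.+1%:R = v' by [].
  have := ler_normB v (v - v'); rewrite subKr.
  move=> /le_trans; apply; have vv1 := le_trans vv' (le_trans hh1 h11).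
  by rewrite lerD.
have -> : ((periodization w D B v)%:C)%C - trig_interp w D L R0 v =
   ((periodization w D B v - periodization w D B v')%:C)%C +
   (trig_interp w D L R0 v' - trig_interp w D L R0 v).
  by rewrite rmorphB /= -g0; ring.
apply: le_trans (le_normcD _ _) _; rewrite normc_real normc_distC.
apply: (@le_trans _ _ (E * `|v - v'|)).
  rewrite [E * _]mulrDl; apply: lerD; first exact: periodization_lip.
  exact: trig_interp_lip (ltW A0).
apply: le_trans h1E; rewrite ler_pM2l //; exact: le_trans vv' hh1.
Qed.

(** * The divisor bound *)

Section divisor_bound.
Variable R : realType.

Lemma powR_natX (p a : nat) (e : R) : ((p ^ a)%N%:R : R) `^ e = (p%:R `^ e) ^+ a.
Proof.
elim: a => [|a IH]; first by rewrite expn0 powR1 expr0.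
by rewrite expnS natrM powRM // IH exprS.
Qed.

Lemma bernoulli_ge (t : R) (a : nat) : 0 <= t -> 1 + a%:R * t <= (1 + t) ^+ a.
Proof.
move=> t0; elim: a => [|a IH]; first by rewrite mul0r addr0.
rewrite exprS -natr1; have : (0 : R) <= a%:R by [].
move: (a%:R) ((1 + t) ^+ a) IH => x y; nra.
Qed.

Lemma size_divisors_partn (p q : nat) : (0 < q)%N -> prime p ->
  (size (divisors q) <= (logn p q).+1 * size (divisors q`_p^'))%N.
Proof.
move=> q0 pp.
rewrite -[(logn p q).+1](size_iota 0) -(size_allpairs (fun i e => p ^ i * e)%N).
apply: uniq_leq_size; first exact: divisors_uniq.
move=> d; rewrite -dvdn_divisors // => dq.
have d0 : (0 < d)%N by exact: dvdn_gt0 dq.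
apply/allpairsP; exists (logn p d, d`_p^')%N; split.
- by rewrite mem_iota add0n ltnS dvdn_leq_log.
- by rewrite /= -dvdn_divisors ?part_gt0 // partn_dvd.
- by rewrite /= -p_part partnC.
Qed.

(** The number of divisors is the product of the [a.+1] over the prime powers [p ^ a] exactly
    dividing [q]. If [p] is at least 2 to the power [eps^-1], then [a.+1 <= 2 ^ a] is at most
    [p ^ a] to the power [eps]; each of the finitely many smaller primes costs at most a factor
    [K]. *)
Lemma size_divisors_le (eps : R) : 0 < eps ->
  exists2 C : R, 0 < C & forall q : nat, (0 < q)%N ->
    (size (divisors q))%:R <= C * q%:R `^ eps.
Proof.
move=> e0.
pose t := eps * ln 2.
have t0 : 0 < t by rewrite mulr_gt0 // ln_gt0 // ltr1n.
(* Chosen so that [a + 1 <= K * (1 + a * t)]; by Bernoulli, [1 + a * t] is at most [(1 + t) ^+ a],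
   where [1 + t] is at most 2 to the power [eps]. *)
pose K := 1 + t^-1.
have K1 : 1 <= K by rewrite lerDl invr_ge0 ltW.
have K0 : 0 < K by exact: lt_le_trans K1.
have two : 1 + t <= 2 `^ eps.
  by rewrite /powR pnatr_eq0 /=; exact: expR_ge1Dx.
pose B := Num.bound (2 `^ eps^-1 : R).
have small (p a : nat) : (2 <= p)%N -> a.+1%:R <= K * (p ^ a)%N%:R `^ eps.
  move=> p2; rewrite powR_natX.
  have : (1 + t) ^+ a <= (p%:R `^ eps) ^+ a.
    apply: lerXn2r; rewrite ?nnegrE ?powR_ge0 ?addr_ge0 ?(ltW t0) //.
    apply: le_trans two _; apply: ge0_ler_powR; rewrite ?nnegrE ?(ltW e0) //.
    by rewrite ler_nat.
  have := bernoulli_ge a (ltW t0).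
  move=> b1 b2; have b3 := le_trans b1 b2.
  apply: (@le_trans _ _ (K * (1 + a%:R * t))); last by rewrite ler_pM2l.
  rewrite -natr1 mulrDr mulr1 addrC; apply: lerD => //.
  rewrite mulrCA -[leLHS]mulr1 ler_wpM2l //.
  by rewrite /K mulrDl mul1r mulVf ?gt_eqF // lerDr ltW.
have large (p a : nat) : (B <= p)%N -> a.+1%:R <= (p ^ a)%N%:R `^ eps :> R.
  move=> Bp; rewrite powR_natX.
  have : 2 ^+ a <= (p%:R `^ eps) ^+ a :> R.
    apply: lerXn2r; rewrite ?nnegrE ?powR_ge0 //.
    have -> : (2 : R) = (2 `^ eps^-1) `^ eps.
      by rewrite -powRrM mulVf ?gt_eqF // powRr1.
    apply: ge0_ler_powR; rewrite ?nnegrE ?powR_ge0 ?(ltW e0) //.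
    have := archi_boundP (powR_ge0 (2 : R) eps^-1) => /ltW /le_trans; apply.
    by rewrite ler_nat.
  apply: le_trans; rewrite -natrX ler_nat; exact: ltn_expl.
(* The induction strips the least prime factor and carries a lower bound [b] on the remaining
   primes; [B - b] then bounds the number of factors [K] still to be paid. *)
suff H (n q b : nat) : (q <= n)%N -> (0 < q)%N -> (forall p, p \in primes q -> b <= p)%N ->
    (size (divisors q))%:R <= K ^+ (B - b) * q%:R `^ eps.
  by exists (K ^+ (B - 0)); [exact: exprn_gt0|move=> q q0; exact: (H q)].
elim: n q b => [|n IH] q b qn q0 hb; first by move: q0; rewrite lt0n; move: qn; rewrite leqn0 => ->.
have [q1|q1] := leqP q 1.
  have -> : q = 1%N by lia.
  by rewrite powR1 mulr1 /= exprn_ege1.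
pose p := pdiv q.
have pp : prime p by exact: pdiv_prime.
have pq : (p %| q)%N by exact: pdiv_dvd.
pose m := (q`_p^')%N.
have m0 : (0 < m)%N by exact: part_gt0.
have qE : (q = p ^ logn p q * m)%N by rewrite -p_part partnC.
have a0 : (0 < logn p q)%N by rewrite logn_gt0 mem_primes pp q0.
have mq : (m <= n)%N.
  rewrite -ltnS; apply: leq_trans qn; rewrite [X in (_ < X)%N]qE ltn_Pmull //.
  by rewrite -(expn0 p) ltn_exp2l // prime_gt1.
have hm r : r \in primes m -> (p.+1 <= r)%N.
  rewrite primes_part mem_filter => /andP[rp rq].
  rewrite ltn_neqAle; apply/andP; split; first by rewrite eq_sym; exact: rp.
  by rewrite pdiv_min_dvd ?prime_gt1 //; move: rq; rewrite mem_primes => /and3P[].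
have bp : (b <= p)%N by apply: hb; rewrite mem_primes pp q0.
have IHm := IH m p.+1 mq m0 hm.
apply: (@le_trans _ _ ((logn p q).+1%:R * (size (divisors m))%:R)).
  by rewrite -natrM ler_nat; exact: size_divisors_partn.
rewrite {2}qE natrM powRM //.
have [Bp|pB] := leqP B p.
  apply: (@le_trans _ _ (((p ^ logn p q)%N%:R `^ eps) * (m%:R `^ eps))).
    apply: ler_pM => //; first exact: large.
    apply: le_trans IHm _; rewrite (_ : (B - p.+1)%N = 0%N) ?mul1r //; lia.
  by rewrite -[leLHS]mul1r ler_wpM2r ?mulr_ge0 ?powR_ge0 // exprn_ege1.
apply: (@le_trans _ _ ((K * (p ^ logn p q)%N%:R `^ eps) * (K ^+ (B - p.+1) * m%:R `^ eps))).
  by apply: ler_pM => //; exact: small (prime_gt1 pp).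
rewrite mulrACA -exprS ler_wpM2r ?mulr_ge0 ?powR_ge0 //.
by apply: ler_weXn2l => //; lia.
Qed.

Lemma count_dvdn_le_size_divisors (N q : nat) : (0 < q)%N ->
  (\sum_(N <= n < N.*2) (n %| q) <= size (divisors q))%N.
Proof.
move=> q0.
rewrite (eq_bigr (fun n => if (n %| q)%N then 1 else 0)%N); last by move=> n _; case: (n %| q)%N.
rewrite -big_mkcond sum1_count -size_filter; apply: uniq_leq_size.
  by rewrite filter_uniq // iota_uniq.
by move=> n; rewrite mem_filter -dvdn_divisors // => /andP[].
Qed.

End divisor_bound.

(** * Finite supports and the product structure of Astar *)

Section finite_esum.
Variables (R : realType) (T : finType) (T' : choiceType) (e : T -> T').
Hypothesis e_inj : injective e.

Lemma esum_fin_pred (P : pred T) (g : T -> R) : (forall t, 0 <= g t) ->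
  \esum_(t in [set t | P t]) (g t)%:E = (\sum_(t | P t) g t)%:E.
Proof.
move=> g0; rewrite esum_fset; last 2 first.
- exact: finite_finset.
- by move=> t _; rewrite lee_fin.
rewrite -sumEFin.
have -> : [set t | P t] = [set` enum P].
  by apply/seteqP; split => t /=; rewrite mem_enum.
by rewrite -fsbig_seq ?enum_uniq // big_enum.
Qed.

Lemma sum_le_esum (P : pred T) (S : set T') (f : T' -> R) : (forall x, 0 <= f x) ->
  (forall t, P t -> S (e t)) ->
  ((\sum_(t | P t) f (e t))%:E <= \esum_(x in S) (f x)%:E)%E.
Proof.
move=> f0 PS; rewrite -(esum_fin_pred P (fun t => f0 (e t))).
rewrite -(@esum_image _ _ _ [set t | P t] e (fun x => (f x)%:E)); last first.
  by move=> t1 t2 _ _; exact: e_inj.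
rewrite [leLHS]esum_mkcond [leRHS]esum_mkcond; apply: le_esum => x _.
case: ifPn => [|_]; last by case: ifP => _ //; rewrite lee_fin.
by rewrite inE => -[t Pt <-]; rewrite ifT // inE; exact: PS.
Qed.

Lemma esum_finite_support (f : T' -> R) : (forall x, 0 <= f x) ->
  (forall x, f x != 0 -> exists t, x = e t) ->
  \esum_(x in [set: T']) (f x)%:E = (\sum_t f (e t))%:E.
Proof.
move=> f0 fs; rewrite -(esum_fin_pred xpredT (fun t => f0 (e t))).
rewrite -(@esum_image _ _ _ [set t | xpredT t] e (fun x => (f x)%:E)); last first.
  by move=> t1 t2 _ _; exact: e_inj.
rewrite [RHS]esum_mkcond; apply: eq_esum => x _.
case: ifPn => // /negP xn; congr (_%:E); apply/eqP/negPn/negP => /fs[t xt].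
by apply: xn; rewrite inE; exists t.
Qed.

End finite_esum.

(** A finite stand-in for the lattice points of [[- B, B]^k], recovered by [boxv]; being finite
    functions, they index the expansion of a product of sums by [bigA_distr_bigA]. *)
Definition box (k B : nat) := {ffun 'I_k -> 'I_(B.*2.+1)}.

Definition boxv (k B : nat) (b : box k B) : 'I_k -> int := fun j => (b j)%:Z - B%:Z.

Lemma boxv_inj (k B : nat) : injective (@boxv k B).
Proof.
move=> b1 b2 h; apply/ffunP => j; apply/val_inj => /=.
by have := congr1 (fun f => f j) h; rewrite /boxv => /addIr [].
Qed.

Lemma boxvP (k B : nat) (a : 'I_k -> int) :
  (forall j, `|a j| <= B%:Z) -> exists b : box k B, a = boxv b.
Proof.
move=> aB.
have hb j : (absz (a j + B%:Z)%R < B.*2.+1)%N by have := aB j; lia.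
exists [ffun j => Ordinal (hb j)]; apply/funext => j; rewrite /boxv ffunE /=.
by have := aB j; lia.
Qed.

Section astar.
Variables (R : realType) (k : nat) (w : R -> R).
Hypothesis wb : bump_fun w.

(** This is [periodization w (n * d) B] at [n * t - y]: in the variable [n * t] the period is 1, so
    the frequencies in [t] are multiples of [n]. *)
Definition astar1 (n B : nat) (d y t : R) : R :=
  \sum_(a < B.*2.+1) w ((n%:R * t - (a%:R - B%:R) - y) / (n%:R * d)).

(** The last hypothesis puts every [a] with a non-zero summand in the box; the lattice sum is then
    finite and factors over the coordinates. *)
Lemma Astar_prod (n B : nat) (dd y : 'I_k -> R) (x : Rk R k) : (0 < n)%N ->
  (forall j, 0 < dd j) ->
  (forall j, n%:R * `|x j| + `|y j| + 2 * (n%:R * dd j) <= B%:R) ->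
  Astar w n dd y x = \prod_(j < k) astar1 n B (dd j) (y j) (x j).
Proof.
move=> n0 d0 hB.
have n0' : (0 : R) < n%:R by rewrite ltr0n.
pose f (a : 'I_k -> int) := wR w dd (fun j => x j - ((a j)%:~R + y j) / n%:R).
have argE j (z : int) : (x j - (z%:~R + y j) / n%:R) / dd j =
    (n%:R * x j - z%:~R - y j) / (n%:R * dd j).
  by field; rewrite !gt_eqF.
rewrite /Astar (esum_finite_support (@boxv_inj k B) (f := f)).
- rewrite /= /f /wR /astar1 bigA_distr_bigA /=; apply: eq_bigr => b _.
  apply: eq_bigr => j _; rewrite argE; congr (w ((_ - _ - _) / _)).
  by rewrite /boxv rmorphB.
- by move=> a; apply: prodr_ge0 => j _; exact: bump_ge0.
move=> a /prodf_neq0 fa; apply: boxvP => j.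
have := fa j isT; rewrite argE => /(bump_support wb); rewrite -ler_norml.
have nd : 0 < n%:R * dd j by rewrite mulr_gt0.
rewrite normrM (gtr0_norm (_ : 0 < (n%:R * dd j)^-1)) ?invr_gt0 // ler_pdivrMr // => h.
have : `|(a j)%:~R : R| <= B%:R.
  apply: le_trans (hB j).
  have -> : ((a j)%:~R : R) = n%:R * x j - y j - (n%:R * x j - (a j)%:~R - y j) by ring.
  apply: le_trans (ler_normB _ _) _; apply: lerD => //.
  by apply: le_trans (ler_normB _ _) _; rewrite normrM gtr0_norm.
by rewrite -[B%:R]/(B%:~R) -intr_norm ler_int.
Qed.

Lemma astar1_ge0 n B d y t : 0 <= astar1 n B d y t.
Proof. by apply: sumr_ge0 => a _; exact: bump_ge0. Qed.

Lemma astar1_le n B d y t : astar1 n B d y t <= B.*2.+1%:R.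
Proof.
have -> : (B.*2.+1%:R : R) = \sum_(a < B.*2.+1) 1 by rewrite sumr_const card_ord.
by apply: ler_sum => a _; exact: bump_le1.
Qed.

Lemma astar1_continuous n B d y : continuous (astar1 n B d y).
Proof.
move=> t; rewrite /astar1; apply: cvg_big => [|a _].
  by move=> u; exact: add_continuous.
apply: continuous_comp; last exact: (bump_continuous wb).
apply: cvgMl; apply: cvgB; last exact: cvg_cst.
apply: cvgB; last exact: cvg_cst.
by apply: cvgMr; exact: cvg_id.
Qed.

End astar.

(** * Integrals of trigonometric sums *)

Section trigonometric_integral.
Context (d : measure_display) (T : measurableType d) (R : realType).
Variables (m : {measure set T -> \bar R}) (D : set T).
Hypotheses (mD : measurable D) (mD1 : m D = 1%E).

Lemma bounded_integrable (f : T -> R) (K : R) : measurable_fun D f ->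
  (forall x, D x -> `|f x| <= K) -> m.-integrable D (EFin \o f).
Proof.
move=> mf fK; apply: measurable_bounded_integrable => //; first by rewrite mD1 ltry.
exists K; split; rewrite ?num_real // => x Kx y Dy /=.
by apply: le_trans (ltW Kx); exact: fK.
Qed.

Lemma Rintegral_sum (I : Type) (s : seq I) (f : I -> T -> R) :
  (forall i, m.-integrable D (EFin \o f i)) ->
  \int[m]_(x in D) (\sum_(i <- s) f i x) = \sum_(i <- s) \int[m]_(x in D) f i x.
Proof.
move=> fi; elim: s => [|i s IH].
  rewrite big_nil -[RHS](mul0r (fine (m D))) -Rintegral_cst //.
  by apply: eq_Rintegral => x _; rewrite big_nil.
rewrite big_cons -IH -RintegralD //.
  by apply: eq_Rintegral => x _; rewrite big_cons.
rewrite (_ : _ \o _ = (fun x => \sum_(i <- s) (EFin \o f i) x)%E); last first.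
  by apply/funext => x /=; rewrite sumEFin.
by apply: integrable_sum.
Qed.

Lemma le_Rintegral_dist (f g : T -> R) (e : R) :
  m.-integrable D (EFin \o f) -> m.-integrable D (EFin \o g) ->
  (forall x, D x -> `|f x - g x| <= e) ->
  `|\int[m]_(x in D) f x - \int[m]_(x in D) g x| <= e.
Proof.
move=> fi gi fg; rewrite -RintegralB //.
have bi : m.-integrable D (EFin \o (fun x => f x - g x)).
  rewrite (_ : _ \o _ = (EFin \o f) \- (EFin \o g))%E; last first.
    by apply/funext => x /=; rewrite EFinB.
  exact: integrableB.
apply: le_trans (le_normr_Rintegral mD bi) _.
have -> : e = \int[m]_(x in D) (cst e) x.
  by rewrite Rintegral_cst // mD1 /= mulr1.
apply: le_Rintegral => //.
- exact: integrable_norm.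
- apply: (@bounded_integrable _ `|e|) => // x _; exact: lexx.
Qed.

Section expansion.
Variables (I : finType) (theta : I -> T -> R) (gam : I -> R[i]) (f : T -> R) (e : R).
Hypotheses (mtheta : forall i, measurable_fun D (theta i))
  (fi : m.-integrable D (EFin \o f))
  (fe : forall x, D x -> normc ((f x)%:C%C - \sum_i gam i * expi (theta i x)) <= e).

Let C i x := cos (2 * pi * theta i x).
Let S i x := sin (2 * pi * theta i x).

Let mC i : measurable_fun D (C i).
Proof.
apply: (measurableT_comp (f := @cos R)).
  exact: continuous_measurable_fun (@continuous_cos R).
by apply: measurable_funM => //; exact: measurable_cst.
Qed.

Let mS i : measurable_fun D (S i).
Proof.
apply: (measurableT_comp (f := @sin R)).
  exact: continuous_measurable_fun (@continuous_sin R).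
by apply: measurable_funM => //; exact: measurable_cst.
Qed.

Let Ci i : m.-integrable D (EFin \o C i).
Proof. by apply: (@bounded_integrable _ 1) => // x _; exact: cos_max. Qed.

Let Si i : m.-integrable D (EFin \o S i).
Proof. by apply: (@bounded_integrable _ 1) => // x _; exact: sin_max. Qed.

Lemma integrable_trig_comb (a b : I -> R) i :
  m.-integrable D (EFin \o (fun x => a i * C i x + b i * S i x)).
Proof.
apply: (@bounded_integrable _ (`|a i| + `|b i|)).
  by apply: measurable_funD; apply: measurable_funM => //; exact: measurable_cst.
move=> x _; apply: le_trans (ler_normD _ _) _.
by rewrite !normrM; apply: lerD; rewrite ler_piMr // ?cos_max ?sin_max.
Qed.

Lemma Rintegral_trig_sum (a b : I -> R) :
  \int[m]_(x in D) (\sum_i (a i * C i x + b i * S i x)) =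
  \sum_i (a i * \int[m]_(x in D) C i x + b i * \int[m]_(x in D) S i x).
Proof.
rewrite Rintegral_sum; last exact: integrable_trig_comb.
apply: eq_bigr => i _.
have iZ (c : R) (h : T -> R) : m.-integrable D (EFin \o h) ->
    m.-integrable D (EFin \o (fun x => c * h x)).
  move=> hi; rewrite (_ : _ \o _ = (fun x => c%:E * (EFin \o h) x)%E); last first.
    by apply/funext => x /=; rewrite EFinM.
  exact: integrableZl.
by rewrite RintegralD ?RintegralZl //; exact: iZ.
Qed.

Lemma integrable_trig_sum (a b : I -> R) :
  m.-integrable D (EFin \o (fun x => \sum_i (a i * C i x + b i * S i x))).
Proof.
rewrite (_ : _ \o _ =
    (fun x => \sum_i (EFin \o (fun x => (a i * C i x + b i * S i x)%R)) x)%E); last first.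
  by apply/funext => x /=; rewrite sumEFin.
by apply: integrable_sum => // i _; exact: integrable_trig_comb.
Qed.

Lemma Re_trig x : complex.Re (\sum_i gam i * expi (theta i x)) =
  \sum_i (complex.Re (gam i) * C i x + (- complex.Im (gam i)) * S i x).
Proof.
rewrite raddf_sum /=; apply: eq_bigr => i _.
by rewrite mulNr /C /S /expi; case: (gam i).
Qed.

Lemma Im_trig x : complex.Im (\sum_i gam i * expi (theta i x)) =
  \sum_i (complex.Im (gam i) * C i x + complex.Re (gam i) * S i x).
Proof.
rewrite raddf_sum /=; apply: eq_bigr => i _.
by rewrite /C /S /expi; case: (gam i) => a b /=; rewrite addrC.
Qed.

(** Stated for any measure giving [D] mass one, since it serves both [mu] on the cube and Lebesgue
    measure on the unit interval. *)
Lemma Rintegral_trig_approx_Re :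
  `|\int[m]_(x in D) f x - \sum_i (complex.Re (gam i) * \int[m]_(x in D) C i x -
      complex.Im (gam i) * \int[m]_(x in D) S i x)| <= e.
Proof.
have -> : \sum_i (complex.Re (gam i) * \int[m]_(x in D) C i x -
      complex.Im (gam i) * \int[m]_(x in D) S i x) =
   \int[m]_(x in D) (\sum_i (complex.Re (gam i) * C i x + (- complex.Im (gam i)) * S i x)).
  by rewrite Rintegral_trig_sum; apply: eq_bigr => i _; rewrite mulNr.
apply: le_Rintegral_dist => //; first exact: integrable_trig_sum.
move=> x Dx; apply: le_trans (fe Dx); rewrite -Re_trig.
apply: le_trans (ler_norm_Re _).
by case: (\sum_i _).
Qed.

(** As [f] is real, the imaginary part of the approximating sum is pure error. *)
Lemma Rintegral_trig_approx_Im :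
  `|\sum_i (complex.Im (gam i) * \int[m]_(x in D) C i x +
      complex.Re (gam i) * \int[m]_(x in D) S i x)| <= e.
Proof.
rewrite -Rintegral_trig_sum.
have z0 : \int[m]_(x in D) (cst 0 x) = 0 :> R by rewrite Rintegral_cst // mul0r.
have ci : m.-integrable D (EFin \o cst (0 : R)).
  by apply: (@bounded_integrable _ 0) => // x _; rewrite normr0.
rewrite -[X in `|X|]subr0 -[X in _ - X]z0.
apply: (le_Rintegral_dist (integrable_trig_sum _ _) ci).
move=> x Dx; apply: le_trans (fe Dx); rewrite -Im_trig subr0.
set z := \sum_i _; rewrite -[leRHS]normcN.
rewrite -(@ler_pXn2r _ 2) ?nnegrE ?normc_ge0 // sqr_normcE real_normK ?num_real //.
case: z => a b /=.
by rewrite [X in _ <= _ + X](_ : _ = b ^+ 2) ?lerDr ?sqr_ge0 //; ring.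
Qed.

End expansion.
End trigonometric_integral.

(** * Iterated Lebesgue integrals *)

Section lebesgue_cube.
Variable R : realType.
Local Notation leb := (@lebesgue_measure R).
Local Notation I01 := (`[(0:R), (1:R)]%classic).

Lemma lebesgue_measure_I01 : leb I01 = 1%E.
Proof. by rewrite lebesgue_measure_itv /= lte_fin ltr01 oppr0 adde0. Qed.

Lemma continuous_integrable_I01 (f : R -> R) : continuous f ->
  leb.-integrable I01 (EFin \o f).
Proof.
move=> cf; apply: continuous_compact_integrable; first exact: segment_compact.
exact: continuous_subspaceT.
Qed.

Lemma leb_int_prod (k : nat) (f : Rk R k -> R) (g : 'I_k -> R -> R) :
  (forall j, continuous (g j)) ->
  (forall x, @unit_cube R k x -> f x = \prod_(j < k) g j (x j)) ->
  leb_int f = \prod_(j < k) \int[leb]_(t in I01) g j t.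
Proof.
move=> cg fg.
(* [lebI] recurses on [nat], so the factors are indexed by [nat] too, with dummy value 1 outside
   ['I_k]. *)
pose G (i : nat) (t : R) := if insub i is Some j then g j t else 1.
have GE (j : 'I_k) t : G j t = g j t by rewrite /G valK.
have cG i : continuous (G i).
  rewrite /G; case: insubP => [j _ _|_]; first exact: cg.
  by move=> x; exact: cvg_cst.
pose J (i : nat) := \int[leb]_(t in I01) G i t.
pose F (z : nat -> R) := ((f (fun j : 'I_k => z j))%:E : \bar R).
(* Coordinates below [m] are integrated; those from [m] on are frozen in [z], and only they must
   already lie in the unit interval. *)
suff H (m : nat) (z : nat -> R) : (m <= k)%N ->
    (forall i, (m <= i < k)%N -> 0 <= z i <= 1) ->
    lebI m F z = (\prod_(0 <= i < m) J i * \prod_(m <= i < k) G i (z i))%:E.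
  rewrite /leb_int H //; last by move=> i; case: leqP => //; lia.
  rewrite /= [X in _ * X]big_geq // mulr1 big_mkord; apply: eq_bigr => j _.
  by apply: eq_Rintegral => t _; rewrite GE.
elim: m z => [|m IH] z mk zi /=.
  rewrite big_geq // mul1r /F fg.
    by rewrite big_mkord; congr (_%:E); apply: eq_bigr => j _; rewrite GE.
  by move=> j /=; apply: zi; rewrite ltn_ord.
pose c := \prod_(0 <= i < m) J i * \prod_(m.+1 <= i < k) G i (z i).
transitivity (\int[leb]_(t in I01) (c%:E * (EFin \o G m) t))%E.
  apply: eq_integral => t; rewrite inE /= in_itv /= => t01.
  rewrite IH ?(ltnW mk) //; last first.
    move=> i /andP[mi ik]; rewrite /upd; case: eqP => // /eqP im; apply: zi.
    by rewrite ltn_neqAle eq_sym im mi ik.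
  rewrite -EFinM; congr (_%:E); rewrite /c -mulrA; congr (_ * _).
  rewrite big_ltn // /upd eqxx mulrC; congr (_ * _).
  apply: eq_big_nat => i /andP[mi _]; rewrite ifN //.
  by rewrite neq_ltn mi orbT.
have iG := continuous_integrable_I01 (cG m).
rewrite integralZl //.
rewrite -[X in (_ * X)%E]fineK; last exact: integrable_fin_num.
rewrite -EFinM; congr (_%:E).
by rewrite /c big_nat_recr //= -mulrA mulrAC -!mulrA; congr (_ * _).
Qed.

Lemma integral_derive_I01 (f F : R -> R) : continuous f ->
  (forall t : R, is_derive t (1 : R) F (f t)) ->
  \int[leb]_(t in I01) f t = F 1 - F 0.
Proof.
move=> cf dF.
have cF : continuous F.
  by move=> x; apply/differentiable_continuous/derivable1_diffP; case: (dF x).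
rewrite /Rintegral (@continuous_FTC2 _ f F 0 1) //=.
- exact: continuous_subspaceT.
- split => [x _||]; first by case: (dF x).
  + by apply: cvg_at_right_filter; exact: cF.
  + by apply: cvg_at_left_filter; exact: cF.
- by move=> x _; rewrite derive1E; apply: derive_val.
Qed.

Lemma integral_cos_I01 (q : int) :
  \int[leb]_(t in I01) cos (2 * pi * (q%:~R * t)) = (q == 0)%:R.
Proof.
have [->|q0] := eqVneq q 0.
  under eq_Rintegral do rewrite mul0r mulr0 cos0.
  by rewrite Rintegral_cst // (_ : fine _ = 1) ?mul1r // [X in fine X]lebesgue_measure_I01.
pose c : R := 2 * pi * q%:~R.
have c0 : c != 0 by rewrite !mulf_neq0 // ?intr_eq0 // gt_eqF // pi_gt0.
have cf : continuous (fun t : R => cos (2 * pi * (q%:~R * t))).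
  move=> x; apply: continuous_comp; last exact: continuous_cos.
  by apply: cvgMr; apply: cvgMr; exact: cvg_id.
have dF (t : R) : is_derive t (1 : R) (fun t : R => c^-1 * sin (c * t))
    (cos (2 * pi * (q%:~R * t))).
  have h : is_derive t (1 : R) (fun x : R => c * x) c.
    by apply: is_derive_eq; rewrite [_ *: _]mulr1.
  have := is_deriveZ c^-1 (is_derive1_comp (is_derive_sin (c * t)) h).
  move=> /is_derive_eq; apply.
  by rewrite [_ *: _]mulrC -[LHS]mulrA divff // mulr1; congr cos; rewrite /c; ring.
rewrite (integral_derive_I01 cf dF) mulr0 sin0 mulr0 subr0 mulr1.
by have := expi_int R q; rewrite /expi -/c => -[_ ->]; rewrite mulr0.
Qed.

Lemma integral_sin_I01 (q : int) :
  \int[leb]_(t in I01) sin (2 * pi * (q%:~R * t)) = 0.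
Proof.
have [->|q0] := eqVneq q 0.
  under eq_Rintegral do rewrite mul0r mulr0 sin0.
  by rewrite Rintegral_cst // mul0r.
pose c : R := 2 * pi * q%:~R.
have c0 : c != 0 by rewrite !mulf_neq0 // ?intr_eq0 // gt_eqF // pi_gt0.
have cf : continuous (fun t : R => sin (2 * pi * (q%:~R * t))).
  move=> x; apply: continuous_comp; last exact: continuous_sin.
  by apply: cvgMr; apply: cvgMr; exact: cvg_id.
have dF (t : R) : is_derive t (1 : R) (fun t : R => - c^-1 * cos (c * t))
    (sin (2 * pi * (q%:~R * t))).
  have h : is_derive t (1 : R) (fun x : R => c * x) c.
    by apply: is_derive_eq; rewrite [_ *: _]mulr1.
  have := is_deriveZ (- c^-1) (is_derive1_comp (is_derive_cos (c * t)) h).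
  move=> /is_derive_eq; apply.
  rewrite [_ *: _]mulrC mulrN !mulNr opprK -[LHS]mulrA divff // mulr1.
  by congr sin; rewrite /c; ring.
rewrite (integral_derive_I01 cf dF) mulr0 cos0 mulr1.
by have := expi_int R q; rewrite /expi -/c => -[-> _]; rewrite subrr.
Qed.

End lebesgue_cube.

(** Telescoping: factors are exchanged one at a time, each exchange costing [e] times a power of
    [H], which [1 <= H] allows to be rounded up to [H ^+ size s]. *)
Lemma normc_prodB_le (R : rcfType) (I : Type) (s : seq I) (a b : I -> R[i]) (H e : R) :
  1 <= H -> (forall i, normc (a i) <= H) -> (forall i, normc (b i) <= H) ->
  (forall i, normc (a i - b i) <= e) ->
  normc (\prod_(i <- s) a i - \prod_(i <- s) b i) <= (size s)%:R * e * H ^+ size s.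
Proof.
move=> H1 aH bH abe.
have H0 : 0 <= H by exact: le_trans ler01 H1.
elim: s => [|i s IH]; first by rewrite !big_nil subrr normc0 mul0r mul0r.
have e0 : 0 <= e by exact: le_trans (normc_ge0 _) (abe i).
have pb : normc (\prod_(j <- s) a j) <= H ^+ size s.
  elim: (s) => [|j s' IHs]; first by rewrite big_nil normc1.
  by rewrite big_cons normcM exprS ler_pM // normc_ge0.
rewrite !big_cons.
have -> : a i * \prod_(j <- s) a j - b i * \prod_(j <- s) b j =
  (a i - b i) * \prod_(j <- s) a j + b i * (\prod_(j <- s) a j - \prod_(j <- s) b j).
  by rewrite mulrBl mulrBr addrA subrK.
apply: le_trans (le_normcD _ _) _; rewrite !normcM /=.
have t1 : normc (a i - b i) * normc (\prod_(j <- s) a j) <= e * H ^+ (size s).+1.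
  apply: ler_pM; rewrite ?normc_ge0 //; apply: le_trans pb _.
  by rewrite exprS ler_peMl // exprn_ge0.
have t2 : normc (b i) * normc (\prod_(j <- s) a j - \prod_(j <- s) b j) <=
    H * ((size s)%:R * e * H ^+ size s).
  by apply: ler_pM; rewrite ?normc_ge0.
apply: le_trans (lerD t1 t2) _.
rewrite le_eqVlt; apply/orP; left; apply/eqP.
by rewrite -natr1 exprS; ring.
Qed.

(** * The discrepancy of a single Astar *)

Section cube.
Variables (R : realType) (k : nat).

Lemma measurable_coord (i : 'I_k) : measurable_fun setT (fun x : Rk R k => x i).
Proof.
move=> _ A mA; rewrite setTI; apply: sub_sigma_algebra.
exists (fun j => if j == i then A else setT); split; first by move=> j; case: ifP.
apply/seteqP; split => x /= h.
  by move=> j; case: eqP => // ->.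
by have := h i; rewrite eqxx.
Qed.

Lemma measurable_unit_cube : measurable (@unit_cube R k).
Proof.
apply: sub_sigma_algebra; exists (fun=> `[0, 1]%classic); split; first by move=> j.
by apply/seteqP; split => x /= h j; have := h j; rewrite in_itv.
Qed.

Lemma measurable_coord_comp (i : 'I_k) (f : R -> R) : continuous f ->
  measurable_fun (@unit_cube R k) (fun x : Rk R k => f (x i)).
Proof.
move=> cf; apply: (@measurable_funS _ _ _ _ setT) => //.
apply: (measurableT_comp (f := f)); first exact: continuous_measurable_fun.
exact: measurable_coord.
Qed.

Lemma measurable_xi_dot (xi : 'I_k -> int) :
  measurable_fun (@unit_cube R k) (fun x : Rk R k => xi_dot xi x).
Proof.
apply: measurable_sum => j; apply: measurable_funM; first exact: measurable_cst.
by apply: (@measurable_funS _ _ _ _ setT) => //; exact: measurable_coord.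
Qed.

Lemma fourier_re0 (mu : probability (Rk R k) R) : mu (@unit_cube R k) = 1%E ->
  fourier_re mu (fun=> 0) = 1.
Proof.
move=> mu1; rewrite /fourier_re /meas_int.
rewrite (eq_integral (cst 1%E)) => [|x _].
  rewrite integral_cst; last exact: measurable_unit_cube.
  by rewrite [X in (_ * X)%E]mu1 mule1.
by rewrite /xi_dot big1 ?mulr0 ?cos0 // => j _; rewrite mul0r.
Qed.

Lemma fourier_im0 (mu : probability (Rk R k) R) : fourier_im mu (fun=> 0) = 0.
Proof.
rewrite /fourier_im /meas_int (eq_integral (cst 0%E)) => [|x _].
  by rewrite integral0 /= oppr0.
by rewrite /xi_dot big1 ?mulr0 ?sin0 // => j _; rewrite mul0r.
Qed.

Lemma fourier_abs_ge0 (mu : probability (Rk R k) R) xi : 0 <= fourier_abs mu xi.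
Proof. exact: sqrtr_ge0. Qed.

End cube.

Section zero_mode.
Variables (R : realType) (n L : nat) (c : 'I_(L.*2.+1) -> R[i]) (g : R -> R) (e : R).
Hypotheses (n0 : (0 < n)%N) (cg : continuous g).
Hypothesis ge : forall t : R, 0 <= t <= 1 ->
  normc ((g t)%:C%C - \sum_i c i * expi ((i%:R - L%:R) * (n%:R * t))) <= e.

(** Only the frequency zero, at index [L], survives integration over the unit interval. Real and
    imaginary parts each err by at most [e]. *)
Lemma zero_mode_le :
  normc ((\int[@lebesgue_measure R]_(t in `[0, 1]) g t)%:C%C - c (inord L)) <= 2 * e.
Proof.
pose q (i : 'I_(L.*2.+1)) : int := (i%:Z - L%:Z) * n%:Z.
pose th (i : 'I_(L.*2.+1)) (t : R) := (q i)%:~R * t.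
have mth (i : 'I_(L.*2.+1)) : measurable_fun `[(0 : R), (1 : R)]%classic (th i).
  by apply: measurable_funM; [exact: measurable_cst|exact: measurable_id].
have he (t : R) : `[(0 : R), (1 : R)]%classic t ->
    normc ((g t)%:C%C - \sum_i c i * expi (th i t)) <= e.
  rewrite /= in_itv /= => t01; apply: le_trans (ge t01).
  rewrite le_eqVlt; apply/orP; left; apply/eqP; congr (normc (_ - _)).
  apply: eq_bigr => i _; congr (_ * expi _); rewrite /th /q rmorphM rmorphB /=.
  by rewrite mulrA.
have iL : L = (inord L : 'I_(L.*2.+1)) :> nat by rewrite inordK //; lia.
have q0 (i : 'I_(L.*2.+1)) : (q i == 0) = (i == inord L).
  rewrite /q mulf_eq0 orbC eqz_nat eqn0Ngt n0 /= subr_eq0 eqz_nat.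
  by apply/eqP/eqP => [h|->]; [apply/val_inj; rewrite /= h -iL|rewrite -iL].
have gi := continuous_integrable_I01 cg.
have mI : measurable `[(0 : R), (1 : R)]%classic by [].
have re := Rintegral_trig_approx_Re (m := @lebesgue_measure R) mI
  (lebesgue_measure_I01 R) mth gi he.
have im := Rintegral_trig_approx_Im (m := @lebesgue_measure R) mI (lebesgue_measure_I01 R) mth he.
have sumE (F : 'I_(L.*2.+1) -> R) : \sum_i F i * (q i == 0)%:R = F (inord L).
  rewrite (bigD1 (inord L)) //= q0 eqxx mulr1 big1 ?addr0 // => i /negPf iN.
  by rewrite q0 iN mulr0.
move: re im.
under eq_bigr do rewrite integral_cos_I01 integral_sin_I01 mulr0 subr0.
under [in X in _ -> X -> _]eq_bigr do rewrite integral_cos_I01 integral_sin_I01 mulr0 addr0.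
rewrite !sumE => re im.
apply: le_trans (normc_le_ReIm _) _.
by case: (c _) re im => a b /= re im; rewrite sub0r normrN; lra.
Qed.

End zero_mode.

(** Serves twice: for one degree [L] common to the [k] coordinates, and for one common to all
    [n < N.*2]. *)
Lemma common_bound (I : finType) (P : I -> nat -> Prop) :
  (forall i, exists L0, forall L, (L0 <= L)%N -> P i L) ->
  exists L0, forall L, (L0 <= L)%N -> forall i, P i L.
Proof.
move=> /choice[f hf]; exists (\max_i f i) => L fL i; apply: hf.
by apply: leq_trans fL; exact: leq_bigmax.
Qed.

Definition dilate (k : nat) (n : nat) (xi : 'I_k -> int) : 'I_k -> int :=
  fun j => n%:Z * xi j.

Section discrepancy.
Variables (R : realType) (k : nat) (mu : probability (Rk R k) R) (w : R -> R).
Hypotheses (mu1 : mu (@unit_cube R k) = 1%E) (wb : bump_fun w).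
Variables (n B L : nat) (dd y : 'I_k -> R) (c : 'I_k -> 'I_(L.*2.+1) -> R[i]) (e : R).
Hypotheses (n0 : (0 < n)%N) (d0 : forall j, 0 < dd j).
Hypothesis hB : forall j, n%:R + `|y j| + 2 * (n%:R * dd j) <= B%:R.
Hypothesis e12 : 0 < e <= 2^-1.
Hypothesis hc : forall j (t : R), 0 <= t <= 1 ->
  normc ((astar1 w n B (dd j) (y j) t)%:C%C
    - \sum_i c j i * expi ((i%:R - L%:R) * (n%:R * t))) <= e.

(** Bounds the factors, by their number of summands, and also their approximations, since the errors
    [e] and [2 * e] are at most 1. *)
Let H : R := B.*2.+1%:R + 1.

Let H1 : 1 <= H. Proof. by rewrite lerDr. Qed.

Let gam (b : box k L) : R[i] := \prod_j c j (b j).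

Let g (j : 'I_k) := astar1 w n B (dd j) (y j).

Let gH j t : normc ((g j t)%:C%C) <= B.*2.+1%:R.
Proof. by rewrite normc_real ger0_norm ?astar1_ge0 ?astar1_le. Qed.

Let AE (x : Rk R k) : unit_cube x -> Astar w n dd y x = \prod_(j < k) g j (x j).
Proof.
move=> xc; apply: Astar_prod => // j; apply: le_trans (hB j).
rewrite -!addrA lerD2r ger0_norm; last by have /andP[] := xc j.
by rewrite ler_piMr //; have /andP[] := xc j.
Qed.

Let near_H (z1 z2 : R[i]) (e' : R) : normc z1 <= B.*2.+1%:R -> normc (z1 - z2) <= e' ->
  e' <= 1 -> normc z2 <= H.
Proof.
move=> h1 h2 h3; have -> : z2 = z1 - (z1 - z2) by rewrite opprB addrC subrK.
by apply: le_trans (le_normcD _ _) _; rewrite normcN lerD // (le_trans h2).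
Qed.

Let prod_expansion (x : Rk R k) :
  \prod_(j < k) \sum_i c j i * expi ((i%:R - L%:R) * (n%:R * x j)) =
  \sum_b gam b * expi (xi_dot (dilate n (boxv b)) x).
Proof.
rewrite bigA_distr_bigA /=; apply: eq_bigr => b _.
rewrite big_split /=; congr (_ * _); rewrite /xi_dot expi_sum; apply: eq_bigr => j _.
congr expi; rewrite /dilate /boxv rmorphM rmorphB /=.
by rewrite mulrA; congr (_ * _); exact: mulrC.
Qed.

Let A_approx (x : Rk R k) : unit_cube x ->
  normc ((\prod_(j < k) g j (x j))%:C%C
    - \sum_b gam b * expi (xi_dot (dilate n (boxv b)) x)) <= k%:R * e * H ^+ k.
Proof.
move=> xc; rewrite -prod_expansion rmorph_prod /=.
have xj j : 0 <= x j <= 1 by exact: xc.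
have := @normc_prodB_le R _ (index_enum 'I_k) (fun j => (g j (x j))%:C%C)
  (fun j => \sum_i c j i * expi ((i%:R - L%:R) * (n%:R * x j))) H e H1.
have -> : size (index_enum 'I_k) = k.
  by rewrite -[RHS](card_ord k) cardE enumT.
apply => j.
- by apply: le_trans (gH j _) _; rewrite lerDl.
- by apply: near_H (gH j (x j)) (hc j (xj j)) _; have /andP[_ ?] := e12; lra.
- exact: hc.
Qed.

Let lam_approx : `|leb_int (Astar w n dd y) - complex.Re (gam [ffun=> inord L])|
   <= k%:R * (2 * e) * H ^+ k.
Proof.
have cg j : continuous (g j) by exact: astar1_continuous.
rewrite (leb_int_prod cg AE).
pose J j := \int[@lebesgue_measure R]_(t in `[0, 1]) g j t.
have zm j := zero_mode_le n0 (cg j) (hc j).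
have J0 j : 0 <= J j by apply: Rintegral_ge0 => t _; exact: astar1_ge0.
have JB j : J j <= B.*2.+1%:R.
  have -> : (B.*2.+1%:R : R) = \int[@lebesgue_measure R]_(t in `[0, 1]) (cst B.*2.+1%:R t).
    rewrite Rintegral_cst // (_ : fine _ = 1) ?mulr1 //.
    by rewrite [X in fine X]lebesgue_measure_I01.
  apply: le_Rintegral => //.
  - exact: continuous_integrable_I01.
  - by apply: continuous_integrable_I01 => x; exact: cvg_cst.
  - by move=> t _; exact: astar1_le.
have := @normc_prodB_le R _ (index_enum 'I_k) (fun j => (J j)%:C%C)
  (fun j => c j (inord L)) H (2 * e) H1.
have -> : size (index_enum 'I_k) = k.
  by rewrite -[RHS](card_ord k) cardE enumT.
move=> h; apply: le_trans (h _ _ _).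
- rewrite -rmorph_prod /=.
  have -> : gam [ffun=> inord L] = \prod_j c j (inord L).
    by apply: eq_bigr => j _; rewrite ffunE.
  apply: le_trans (ler_norm_Re _).
  have ReB (x : R) (z : R[i]) : complex.Re (x%:C%C - z) = x - complex.Re z by case: z.
  by rewrite ReB.
- by move=> j; rewrite normc_real ger0_norm // (le_trans (JB j)) // lerDl.
- move=> j; apply: near_H (zm j) _; last by have /andP[_ ?] := e12; lra.
  by rewrite normc_real ger0_norm; [exact: JB|exact: J0].
- exact: zm.
Qed.

(** The expansion uses [expi], the conjugate of the kernel in the Fourier coefficients; hence the
    sign of [fourier_im], which leaves the modulus unchanged. *)
Let re_term b := complex.Re (gam b) * fourier_re mu (dilate n (boxv b))
  - complex.Im (gam b) * - fourier_im mu (dilate n (boxv b)).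

Let mu_approx : `|meas_int mu (Astar w n dd y) - \sum_b re_term b| <= k%:R * e * H ^+ k.
Proof.
have mcube : measurable (@unit_cube R k) := @measurable_unit_cube R k.
pose A (x : Rk R k) := \prod_(j < k) g j (x j).
have Ai : mu.-integrable (@unit_cube R k) (EFin \o A).
  apply: (bounded_integrable mcube mu1 (K := B.*2.+1%:R ^+ k)).
    apply: measurable_prod => j _; apply: measurable_coord_comp.
    exact: astar1_continuous.
  move=> x _; rewrite /A normr_prod -[X in _ ^+ X](card_ord k) -prodr_const.
  apply: ler_prod => j _; rewrite normr_ge0 /= ger0_norm ?astar1_le //.
  exact: astar1_ge0.
have mth (b : box k L) := @measurable_xi_dot R k (dilate n (boxv b)).
have := Rintegral_trig_approx_Re mcube mu1 mth Ai A_approx.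
rewrite (_ : meas_int mu (Astar w n dd y) = \int[mu]_(x in unit_cube (k:=k)) A x); last first.
  by apply: eq_Rintegral => x; rewrite inE => xc; exact: AE.
congr (`|_ - _| <= _); apply: eq_bigr => b _.
by rewrite /re_term /fourier_im opprK.
Qed.

(** Both integrals are compared with the same coefficient at frequency zero, which cancels. The 3 is
    one unit for [mu] and two for Lebesgue measure, whose factors are known up to [2 * e]. *)
Lemma discrepancy_trig_le :
  `|meas_int mu (Astar w n dd y) - leb_int (Astar w n dd y)| <=
    3 * k%:R * e * H ^+ k +
    \sum_(b : box k L | [exists j, boxv b j != 0])
      normc (\prod_j c j (b j)) * fourier_abs mu (dilate n (boxv b)).
Proof.
pose b0 : box k L := [ffun=> inord L].
have bv0 : dilate n (boxv b0) = (fun=> 0).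
  apply/funext => j; rewrite /dilate /boxv ffunE inordK ?subrr ?mulr0 //; lia.
have b0P b : [exists j, boxv b j != 0] = (b != b0).
  apply/existsP/idP => [[j]|].
    apply: contra => /eqP ->; rewrite /boxv ffunE inordK ?subrr //; lia.
  move=> bb0; apply/existsP; apply: contraR bb0 => /existsPn h.
  apply/eqP/ffunP => j; apply/val_inj; rewrite ffunE /= inordK; last by lia.
  by have := h j; rewrite negbK /boxv; lia.
have sumE : \sum_b re_term b = complex.Re (gam b0) +
    \sum_(b : box k L | [exists j, boxv b j != 0]) re_term b.
  rewrite (bigD1 b0) //=; congr (_ + _).
    by rewrite /re_term bv0 fourier_re0 // fourier_im0 oppr0 mulr0 subr0 mulr1.
  by apply: eq_bigl => b; rewrite b0P.
have -> : meas_int mu (Astar w n dd y) - leb_int (Astar w n dd y) =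
   (meas_int mu (Astar w n dd y) - \sum_b re_term b) -
   (leb_int (Astar w n dd y) - complex.Re (gam b0)) +
   \sum_(b : box k L | [exists j, boxv b j != 0]) re_term b.
  by rewrite sumE; ring.
apply: le_trans (ler_normD _ _) _; apply: lerD.
  apply: le_trans (ler_normB _ _) _.
  apply: le_trans (lerD mu_approx lam_approx) _.
  by rewrite le_eqVlt; apply/orP; left; apply/eqP; ring.
apply: le_trans (ler_norm_sum _ _ _) _; apply: ler_sum => b _.
set xi := dilate n (boxv b).
have -> : fourier_abs mu xi = normc (Complex (fourier_re mu xi) (- fourier_im mu xi)).
  by rewrite /fourier_abs /normc /= [in RHS]sqrrN.
exact: (ler_norm_ReM (gam b) (Complex (fourier_re mu xi) (- fourier_im mu xi))).
Qed.

End discrepancy.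

(** * The l1-dimension *)

Lemma normr_meas_int_le1 (R : realType) (k : nat) (mu : probability (Rk R k) R)
    (f : Rk R k -> R) : mu (@unit_cube R k) = 1%E ->
  measurable_fun (@unit_cube R k) f -> (forall x, `|f x| <= 1) -> `|meas_int mu f| <= 1.
Proof.
move=> mu1 mf f1.
have mcube : measurable (@unit_cube R k) := @measurable_unit_cube R k.
have fi : mu.-integrable (@unit_cube R k) (EFin \o f).
  by apply: (bounded_integrable mcube mu1 (K := 1)).
have zi : mu.-integrable (@unit_cube R k) (EFin \o cst (0 : R)).
  by apply: (bounded_integrable mcube mu1 (K := 0)) => // x _; rewrite normr0.
have := le_Rintegral_dist mcube mu1 fi zi (e := 1).
rewrite Rintegral_cst // mul0r subr0; apply => x _.
by rewrite subr0.
Qed.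

Section dimension.
Variables (R : realType) (k : nat) (mu : probability (Rk R k) R).
Hypothesis mu1 : mu (@unit_cube R k) = 1%E.

Lemma fourier_abs_le2 xi : fourier_abs mu xi <= 2.
Proof.
have mx := @measurable_xi_dot R k xi.
have m2 : measurable_fun (@unit_cube R k) (fun x : Rk R k => 2 * pi * xi_dot xi x).
  by apply: measurable_funM => //; exact: measurable_cst.
have re1 : `|fourier_re mu xi| <= 1.
  apply: normr_meas_int_le1 => //; last by move=> x; exact: cos_max.
  apply: (measurableT_comp (f := @cos R)) => //.
  exact: continuous_measurable_fun (@continuous_cos R).
have im1 : `|fourier_im mu xi| <= 1.
  rewrite normrN; apply: normr_meas_int_le1 => //; last by move=> x; exact: sin_max.
  apply: (measurableT_comp (f := @sin R)) => //.
  exact: continuous_measurable_fun (@continuous_sin R).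
have := normc_le_ReIm (Complex (fourier_re mu xi) (fourier_im mu xi)).
rewrite /normc /= -/(fourier_abs mu xi); lra.
Qed.

Lemma fourier_abs0 : fourier_abs mu (fun=> 0) = 1.
Proof. by rewrite /fourier_abs fourier_re0 // fourier_im0 expr0n addr0 expr1n sqrtr1. Qed.

Let dim_set := [set s : R | 0 <= s /\
  exists C : R, forall Q : R, 1 <= Q ->
    (\esum_(xi in @freq_box k R Q) (fourier_abs mu xi)%:E <= (C * Q `^ (k%:R - s))%:E)%E].

(** The trivial bound: at most [(3 * Q) ^+ k] frequencies, each contributing at most 2. *)
Lemma dim_set0 : dim_set 0.
Proof.
split => //; exists (2 * 3 ^+ k) => Q Q1.
have Q0 : 0 <= Q by exact: le_trans ler01 Q1.
pose B := Num.truncn Q.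
have /andP[BQ QB] := truncn_itv Q0.
pose f (xi : 'I_k -> int) : R := if [forall j, `|xi j| <= B%:Z] then fourier_abs mu xi else 0.
have f0 xi : 0 <= f xi by rewrite /f; case: ifP => // _; exact: fourier_abs_ge0.
rewrite subr0 powR_mulrn // esum_mkcond.
apply: (@le_trans _ _ (\esum_(xi in [set: 'I_k -> int]) (f xi)%:E)%E).
  apply: le_esum => xi _; case: ifPn => [|_]; last by rewrite lee_fin.
  rewrite inE => xiQ; rewrite /f ifT //; apply/forallP => j.
  have := le_lt_trans (xiQ j) QB.
  rewrite -[(Num.truncn Q).+1%:R]/((Num.truncn Q).+1%:~R) ltr_int -/B.
  by move: (B) => B'; lia.
rewrite (esum_finite_support (@boxv_inj k B)) //.
  rewrite lee_fin.
  apply: (@le_trans _ _ (\sum_(b : box k B) 2)).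
    apply: ler_sum => b _; rewrite /f; case: ifP => // _; exact: fourier_abs_le2.
  rewrite sumr_const card_ffun !card_ord -[leLHS]mulr_natr natrX -mulrA.
  rewrite ler_pM2l // -exprMn; apply: lerXn2r; rewrite ?nnegrE ?mulr_ge0 //.
  have -> : (B.*2.+1%:R : R) = B%:R + B%:R + 1 by rewrite -addnn -natr1 natrD.
  by rewrite /B; lra.
move=> xi; rewrite /f; case: ifPn => [/forallP h _|_]; last by rewrite eqxx.
exact: boxvP.
Qed.

(** The zero frequency alone contributes 1, whereas for [s] beyond [k] the bound would tend to 0.
    With [dim_set0] this makes the supremum a genuine one. *)
Lemma dim_set_le s : dim_set s -> s <= k%:R.
Proof.
move=> [s0 [C hC]]; rewrite leNgt; apply/negP => sk.
have one (Q : R) : 1 <= Q -> 1 <= C * Q `^ (k%:R - s).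
  move=> Q1; rewrite -lee_fin; apply: le_trans (hC Q Q1).
  have := @sum_le_esum R unit _ (fun=> (fun=> 0)) _ xpredT (@freq_box k R Q)
    (fourier_abs mu) (fourier_abs_ge0 mu).
  rewrite big_const card_unit /= addr0 fourier_abs0; apply.
  - by move=> [] [].
  - by move=> _ _ j; rewrite normr0; apply: le_trans Q1.
have C1 : 1 <= C by have := one 1 (lexx _); rewrite powR1 mulr1.
pose r := s - k%:R.
have r0 : 0 < r by rewrite subr_gt0.
(* At this [Q] the bound equals [2^-1], below the contribution of the zero frequency. *)
pose Q := (2 * C) `^ r^-1.
have C2 : 1 <= 2 * C by lra.
have Q1 : 1 <= Q.
  by rewrite -(powRr0 (2 * C)) /Q ler_powR // invr_ge0 ltW.
have := one Q Q1; rewrite /Q -powRrM.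
have -> : r^-1 * (k%:R - s) = - 1.
  by rewrite (_ : k%:R - s = - r) ?mulrN ?mulVf ?gt_eqF // /r opprB.
rewrite powR_inv1; last by lra.
by rewrite invfM mulrCA divff ?mulr1 ?gt_eqF; lra.
Qed.

(** The supremum need not be attained, so the dimension is used through an admissible exponent close
    to it. *)
Lemma dim_l1_approx (e : R) : 0 < e ->
  exists2 s : R, 0 <= s & dim_l1 mu - e < s /\ exists2 C : R, 0 < C & forall Q : R, 1 <= Q ->
    (\esum_(xi in @freq_box k R Q) (fourier_abs mu xi)%:E <= (C * Q `^ (k%:R - s))%:E)%E.
Proof.
move=> e0.
have hs : has_sup dim_set.
  split; first by exists 0; exact: dim_set0.
  by exists k%:R => s; exact: dim_set_le.
have [s [s0 [C hC]] es] := sup_adherent e0 hs.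
exists s => //; split => //; exists (`|C| + 1); first by rewrite ltr_wpDl.
move=> Q Q1; apply: le_trans (hC Q Q1) _; rewrite lee_fin ler_wpM2r ?powR_ge0 //.
by apply: le_trans (ler_norm C) _; rewrite lerDl.
Qed.

End dimension.

(** * Summation over frequencies *)

(** The order of the quantifiers matters: [K] precedes [mu], [n], [dd], [y] and [delta], on which
    only the degree depends. The decay is available in any one coordinate, the other factors being
    bounded trivially. *)
Lemma discrepancy_le (R : realType) (k : nat) (w : R -> R) (M : nat) :
  bump_fun w -> (3 <= M)%N ->
  exists2 K : R, 0 < K & forall (mu : probability (Rk R k) R) (n : nat)
      (dd y : 'I_k -> R) (delta : R),
    mu (@unit_cube R k) = 1%E -> (0 < n)%N -> (forall j, 0 < dd j) -> 0 < delta ->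
    exists L0 : nat, forall L, (L0 <= L)%N -> exists gam : box k L -> R,
      [/\ forall b, 0 <= gam b,
          forall b, gam b <= \prod_(j < k) (K * (n%:R * dd j)),
          forall b j, gam b * (n%:R * dd j * `|boxv b j|%:~R) ^+ M
            <= \prod_(j < k) (K * (n%:R * dd j)) &
          `|meas_int mu (Astar w n dd y) - leb_int (Astar w n dd y)| <= delta +
            \sum_(b : box k L | [exists j, boxv b j != 0])
              gam b * fourier_abs mu (dilate n (boxv b))].
Proof.
move=> wb M3; have [K K0 hK] := periodization_approx wb M3.
exists K => // mu n dd y delta mu1 n0 d0 delta0.
have n0' : (0 : R) < n%:R by rewrite ltr0n.
pose Y := \sum_(j < k) (n%:R + `|y j| + 2 * (n%:R * dd j) + 1).
have Yge j : 0 <= n%:R + `|y j| + 2 * (n%:R * dd j) + 1.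
  by rewrite !addr_ge0 // mulr_ge0 // mulr_ge0 // ltW.
pose B := Num.bound Y.
have hB j : n%:R + `|y j| + 2 * (n%:R * dd j) + 1 <= B%:R.
  have Y0 : 0 <= Y by apply: sumr_ge0.
  apply: le_trans (ltW (archi_boundP Y0)).
  by rewrite /Y (bigD1 j) //= lerDl sumr_ge0.
pose H : R := B.*2.+1%:R + 1.
have H0 : 0 < H by rewrite addr_gt0.
have [e /andP[e0 e12] he] : exists2 e : R, 0 < e <= 2^-1 & 3 * k%:R * e * H ^+ k <= delta.
  (* Adding 1 keeps [X] positive when [k = 0]. *)
  pose X := 3 * k%:R * H ^+ k + 1.
  have X0 : 0 < X by rewrite ltr_wpDl // mulr_ge0 ?mulr_ge0 // exprn_ge0 // ltW.
  exists (Num.min 2^-1 (delta / X)).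
    by rewrite lt_min invr_gt0 ltr0n divr_gt0 //= ge_min lexx.
  apply: (@le_trans _ _ (X * (delta / X))); last by rewrite mulrC divfK // gt_eqF.
  rewrite mulrAC; apply: ler_pM.
  - by rewrite !mulr_ge0 // exprn_ge0 // ltW.
  - by rewrite le_min invr_ge0 ler0n divr_ge0 // ltW.
  - by rewrite /X lerDl.
  - by rewrite ge_min lexx orbT.
have nd0 j : 0 < n%:R * dd j by rewrite mulr_gt0.
have [L0 hL0] := common_bound (fun j => hK _ _ _ _ _ (nd0 j) e0 (hB j)).
exists L0 => L L0L; have /choice[c hc] := hL0 L L0L.
exists (fun b => normc (\prod_j c j (b j))); split.
- by move=> b; exact: normc_ge0.
- move=> b; rewrite normc_prod; apply: ler_prod => j _.
  by rewrite normc_ge0 /=; have [h _ _] := hc j; exact: h.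
- move=> b j; rewrite normc_prod (bigD1 j) //= [leRHS](bigD1 j) //= mulrAC.
  apply: ler_pM.
  + by rewrite mulr_ge0 ?normc_ge0 // exprn_ge0 // !mulr_ge0 ?(ltW (d0 _)) // ler0z.
  + by apply: prodr_ge0 => i _; exact: normc_ge0.
  + have [_ h _] := hc j; apply: le_trans (h (b j)).
    rewrite le_eqVlt; apply/orP; left; apply/eqP; congr (_ * (_ * _) ^+ _).
    by rewrite intr_norm /boxv rmorphB.
  + apply: ler_prod => i _; rewrite normc_ge0 /=.
    by have [h _ _] := hc i; exact: h.
- apply: le_trans (discrepancy_trig_le (B := B) (e := e) (c := c) mu1 wb n0 d0 _ _ _) _.
  + by move=> j; have := hB j; lra.
  + by rewrite e0.
  + move=> j t /andP[t0 t1]; have [_ _ h] := hc j; apply: h.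
    by rewrite normrM !ger0_norm // ler_piMr.
  + by rewrite lerD2r.
Qed.

(** * Frequencies [n xi] and their multiplicities *)

Definition maxabs (k : nat) (xi : 'I_k -> int) : nat := \max_(j < k) absz (xi j).

Lemma maxabs_dilate (k n : nat) (xi : 'I_k -> int) :
  maxabs (dilate n xi) = (n * maxabs xi)%N.
Proof.
rewrite /maxabs /dilate; apply: (big_rec2 (fun x y => x = n * y)%N).
  by rewrite muln0.
by move=> j a b _ ->; rewrite abszM /= maxnMr.
Qed.

Lemma maxabs_attained (k : nat) (xi : 'I_k -> int) : [exists j, xi j != 0] ->
  exists j, maxabs xi = absz (xi j).
Proof.
case/existsP => j0 _; have k0 : (0 < #|'I_k|)%N by apply/card_gt0P; exists j0.
by have [j hj] := bigop.eq_bigmax (fun j => absz (xi j)) k0; exists j.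
Qed.

Lemma maxabs_gt0 (k : nat) (xi : 'I_k -> int) : [exists j, xi j != 0] -> (0 < maxabs xi)%N.
Proof.
case/existsP => j xj; apply: leq_trans (leq_bigmax j).
by rewrite lt0n absz_eq0.
Qed.

Lemma ler_sum_inj (R : realType) (T T' : finType) (f : T -> T') (P : pred T) (Q : pred T')
    (G : T' -> R) :
  injective f -> (forall t, P t -> Q (f t)) -> (forall t, 0 <= G t) ->
  \sum_(t | P t) G (f t) <= \sum_(t' | Q t') G t'.
Proof.
move=> fi PQ G0.
have -> : \sum_(t | P t) G (f t) = \sum_(t' in f @: [set t | P t]%SET) G t'.
  rewrite big_imset /=; last by move=> x y _ _; exact: fi.
  by apply: eq_bigl => t; rewrite !finset.inE.
rewrite [leRHS](bigID (mem (f @: [set t | P t]%SET))) /=.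
rewrite [X in X + _](_ : _ = \sum_(t' in f @: [set t | P t]%SET) G t').
  by rewrite lerDl sumr_ge0.
apply: eq_bigl => t'; apply/andP/idP => [[]//|h]; split => //.
by case/imsetP: h => t; rewrite finset.inE => Pt ->; exact: PQ.
Qed.

(* [m = n xi] forces [n] to divide [maxabs m]. *)
Lemma sum_dilate_le (R : realType) (k N L : nat) (F : ('I_k -> int) -> R) :
  (0 < N)%N -> (forall xi, 0 <= F xi) ->
  \sum_(N <= n < N.*2) \sum_(b : box k L | [exists j, boxv b j != 0])
      F (dilate n (boxv b)) <=
  \sum_(m : box k (N.*2 * L) | [exists j, boxv m j != 0])
      (size (divisors (maxabs (boxv m))))%:R * F (boxv m).
Proof.
move=> N0 F0.
set B := (N.*2 * L)%N.
apply: (@le_trans _ _ (\sum_(N <= n < N.*2)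
   \sum_(m : box k B | [exists j, boxv m j != 0])
     (n %| maxabs (boxv m))%N%:R * F (boxv m))).
  apply: ler_sum_nat => n /andP[Nn nN].
  have n0 : (0 < n)%N by exact: leq_trans Nn.
  have inB (b : box k L) : exists m : box k B, dilate n (boxv b) = boxv m.
    apply: boxvP => j; rewrite /dilate /boxv /B.
    have := ltn_ord (b j); move: (nat_of_ord (b j)) => i iL.
    have h1 : `|i%:Z - L%:Z| <= L%:Z by lia.
    rewrite normrM; apply: (@le_trans _ _ (N.*2%:Z * L%:Z)); last by rewrite PoszM.
    by apply: ler_pM => //; lia.
  have /choice[phi hphi] := inB.
  have phii : injective phi.
    move=> b1 b2 h; apply: (@boxv_inj k L); apply/funext => j.
    have := congr1 (fun f => f j) (hphi b1); rewrite h -hphi /dilate.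
    by move/mulfI => ->//; lia.
  pose G (m : box k B) := (n %| maxabs (boxv m))%N%:R * F (boxv m).
  have := @ler_sum_inj R _ _ phi (fun b => [exists j, boxv b j != 0])
    (fun m => [exists j, boxv m j != 0]) G phii.
  have GE (b : box k L) : G (phi b) = F (dilate n (boxv b)).
    by rewrite /G -hphi maxabs_dilate dvdn_mulr // mul1r.
  move=> h; apply: le_trans (h _ _).
  - by apply: ler_sum => b _; rewrite GE.
  - move=> b /existsP[j bj]; apply/existsP; exists j.
    by rewrite -hphi /dilate mulf_neq0 //; lia.
  - by move=> m; rewrite mulr_ge0.
rewrite exchange_big /=; apply: ler_sum => m mn.
rewrite -mulr_suml ler_wpM2r // -natr_sum ler_nat.
exact: count_dvdn_le_size_divisors (maxabs_gt0 mn).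
Qed.

(** * Dyadic summation against a decaying weight *)

Lemma ex_dyadic (R : realType) (H : R) (q B : nat) : 1 <= H -> (q <= B)%N ->
  exists2 i : nat, (i <= B)%N & q%:R <= 2 ^+ i * H /\ ((0 < i)%N -> 2 ^+ i * H < 2 * q%:R).
Proof.
move=> H1 qB.
have ex : exists i : nat, q%:R <= 2 ^+ i * H.
  exists q; apply: (@le_trans _ _ (2 ^+ q)); last by rewrite ler_peMr // exprn_ge0.
  by rewrite -natrX ler_nat ltnW // ltn_expl.
case: (ex_minnP ex) => i hi imin; exists i.
  apply: leq_trans qB; apply: imin.
  apply: (@le_trans _ _ (2 ^+ q)); last by rewrite ler_peMr // exprn_ge0.
  by rewrite -natrX ler_nat ltnW // ltn_expl.
split => // i0; case: i hi imin i0 => // i _ imin _.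
rewrite exprS -mulrA ltr_pM2l // ltNge; apply/negP => /imin.
by rewrite ltnn.
Qed.

(** Morally the minimum of 1 and [(H / maxabs xi) ^+ M]; the case split gives 1 at [xi = 0], where
    [H / 0] is 0. *)
Definition decay_weight (R : realType) (k : nat) (H : R) (M : nat) (xi : 'I_k -> int) : R :=
  if (maxabs xi)%:R <= H then 1 else (H / (maxabs xi)%:R) ^+ M.

Lemma maxabs_boxv_le (k B : nat) (m : box k B) : (maxabs (boxv m) <= B)%N.
Proof.
apply/bigmax_leqP => j _; rewrite /boxv.
by have := ltn_ord (m j); move: (nat_of_ord (m j)) => i; lia.
Qed.

(** Let [T = 2 ^+ i * H]. Frequencies of size between [T / 2] and [T] have weight at most
    [T^e * (2 / 2^i)^M] and total mass at most [C * T^sg]. As [sg + e <= M - 1], scale [i]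
    contributes at most [2^-i] times [C * 2^M * H^(sg + e)], and the geometric series supplies the
    last factor 2. *)
Lemma dyadic_sum_le (R : realType) (k B M : nat) (nu : ('I_k -> int) -> R) (C H sg e : R) :
  0 <= C -> 1 <= H -> 0 <= e -> sg + e + 1 <= M%:R ->
  (forall xi, 0 <= nu xi) ->
  (forall Q : R, 1 <= Q ->
    \sum_(m : box k B | (maxabs (boxv m))%:R <= Q) nu (boxv m) <= C * Q `^ sg) ->
  \sum_(m : box k B) (maxabs (boxv m))%:R `^ e * decay_weight H M (boxv m) * nu (boxv m)
    <= C * 2 ^+ M.+1 * H `^ (sg + e).
Proof.
move=> C0 H1 e0 sgM nu0 hS.
have H0 : 0 < H by exact: lt_le_trans H1.
have p2 (i : nat) : (0 : R) < 2 ^+ i by rewrite exprn_gt0.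
have T1 (i : nat) : 1 <= 2 ^+ i * H by rewrite mulr_ege1 // exprn_ege1 // ler1n.
pose a (i : nat) := (2 ^+ i * H) `^ e * (2 ^+ M / (2 ^+ i) ^+ M).
have a0 i : 0 <= a i by rewrite mulr_ge0 ?powR_ge0 // divr_ge0 // exprn_ge0 // ltW.
(* Every scale above [maxabs m] may contribute, not only the least one. This harmless overcounting
   produces sums over full boxes, to which [hS] applies. *)
have pt (m : box k B) : (maxabs (boxv m))%:R `^ e * decay_weight H M (boxv m) <=
    \sum_(i < B.+1) (if (maxabs (boxv m))%:R <= 2 ^+ i * H then a i else 0).
  have [i iB [hi hi2]] := ex_dyadic H1 (maxabs_boxv_le m).
  have iB' : (i < B.+1)%N by [].
  rewrite (bigD1 (Ordinal iB')) //= hi.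
  apply: (@le_trans _ _ (a i)); last first.
    by rewrite lerDl sumr_ge0 // => j _; case: ifP.
  have dw0 : 0 <= decay_weight H M (boxv m).
    by rewrite /decay_weight; case: ifP => // _; rewrite exprn_ge0 // divr_ge0 // ltW.
  apply: ler_pM; rewrite ?powR_ge0 //.
    by apply: ge0_ler_powR; rewrite ?nnegrE // ltW // mulr_gt0.
  rewrite -expr_div_n /decay_weight.
  case: (posnP i) => [->|i0].
    rewrite expr0 divr1; case: ifPn => [_|].
      by rewrite exprn_ege1 // ler1n.
    rewrite -ltNge => qH; have q0 : (0 : R) < (maxabs (boxv m))%:R by exact: lt_trans qH.
    apply: lerXn2r; rewrite ?nnegrE ?divr_ge0 // ?(ltW H0) //.
    by rewrite ler_pdivrMr //; lra.
  have := hi2 i0; set q := (maxabs (boxv m))%:R => h2.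
  have h21 : 2 * H <= 2 ^+ i * H.
    by rewrite ler_pM2r // -{1}(expr1 2) ler_weXn2l // ler1n.
  have qH : H < q by lra.
  rewrite ifN; last by rewrite -ltNge.
  have q0 : 0 < q by exact: lt_trans qH.
  apply: lerXn2r; rewrite ?nnegrE ?divr_ge0 // ?(ltW q0) ?(ltW H0) ?(ltW (p2 _)) //.
  by rewrite ler_pdivrMr // mulrAC ler_pdivlMr // mulrC ltW.
apply: (@le_trans _ _ (\sum_(m : box k B) \sum_(i < B.+1)
    (if (maxabs (boxv m))%:R <= 2 ^+ i * H then a i * nu (boxv m) else 0))).
  apply: ler_sum => m _; apply: le_trans (ler_wpM2r (nu0 _) (pt m)) _.
  rewrite mulr_suml; apply: ler_sum => i _; case: ifP => // _.
  by rewrite mul0r.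
rewrite exchange_big /=.
apply: (@le_trans _ _ (\sum_(i < B.+1) (C * 2 ^+ M * H `^ (sg + e)) * (2^-1) ^+ i)).
  apply: ler_sum => i _; rewrite -big_mkcond /= -mulr_sumr.
  apply: le_trans (ler_wpM2l (a0 i) (hS _ (T1 i))) _.
  have -> : a i * (C * (2 ^+ i * H) `^ sg) =
     C * 2 ^+ M * ((2 ^+ i) ^- M * (2 ^+ i * H) `^ (sg + e)).
    rewrite powRD; last by apply/implyP => _; rewrite gt_eqF // mulr_gt0.
    by rewrite /a; ring.
  rewrite -[leRHS]mulrA ler_wpM2l ?mulr_ge0 ?exprn_ge0 //.
  rewrite powRM ?(ltW H0) ?(ltW (p2 _)) // [(2 ^+ i) `^ _ * _]mulrC mulrCA ler_wpM2l ?powR_ge0 //.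
  apply: (@le_trans _ _ ((2 ^+ i) ^- M * (2 ^+ i) `^ (M%:R - 1))).
    rewrite ler_wpM2l ?invr_ge0 ?exprn_ge0 ?(ltW (p2 _)) //.
    by apply: ler_powR; [rewrite exprn_ege1 // ler1n|lra].
  rewrite powRD; last by apply/implyP => _; rewrite gt_eqF.
  rewrite powR_mulrn ?(ltW (p2 _)) // powR_inv1 ?(ltW (p2 _)) //.
  by rewrite mulrA mulVf ?mul1r ?exprVn // expf_neq0 // gt_eqF.
rewrite -mulr_sumr exprS.
have geo : \sum_(i < B.+1) (2^-1 : R) ^+ i <= 2.
  have := subrX1 (2^-1 : R) B.+1; set S := \sum_(i < _) _ => h.
  have : (0 : R) <= 2^-1 ^+ B.+1 by rewrite exprn_ge0.
  lra.
have -> : C * (2 * 2 ^+ M) * H `^ (sg + e) = C * 2 ^+ M * H `^ (sg + e) * 2 by ring.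
by rewrite ler_wpM2l // !mulr_ge0 ?powR_ge0 // exprn_ge0.
Qed.

Theorem theorem3p2 (R : realType) (k : nat) (w : R -> R) (tau eps c1 c2 : R)
    (mu : probability (Rk R k) R) (kappa : R) :
  bump_fun w -> 0 < tau -> 0 < eps -> 0 < c1 -> 0 < c2 ->
  mu (@unit_cube R k) = 1%E ->
  kappa = dim_l1 mu ->
  exists C : R, forall (N : nat) (d : R) (dd y : 'I_k -> R),
    0 < d <= 2^-1 ->
    (forall j, 0 < dd j <= 2^-1) ->
    (forall j, c1 * (N%:R `^ (- tau)) * d <= dd j <= c2 * (N%:R `^ tau) * d) ->
    `| \sum_(N <= n < N.*2)
          (meas_int mu (Astar w n dd y) - leb_int (Astar w n dd y)) |
      <= C * N%:R `^ (k%:R + (2 * k%:R + eps) * tau + eps) * d `^ (kappa - eps).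
Proof.
move=> wb tau0 eps0 c10 c20 mu1 ->.
have eps20 : 0 < eps / 2 by rewrite divr_gt0.
(* Half of [eps] goes to the divisor bound and half to the gap between [s] and the dimension; the
   cap at 1 lets [M] depend on [k] only. *)
pose e := Num.min (eps / 2) 1.
have e0 : 0 < e by rewrite lt_min eps20 ltr01.
have e_eps : e <= eps / 2 by rewrite ge_min lexx.
have e1 : e <= 1 by rewrite ge_min lexx orbT.
have [s s0 [ks [Cs Cs0 hCs]]] := dim_l1_approx mu1 eps20.
(* Since [0 <= s] and [e <= 1], this exceeds [k - s + e + 1]; it is also at least 3 when [k = 0]. *)
pose M := (k + 3)%N.
have M3 : (3 <= M)%N by rewrite leq_addl.
have [K K0 hK] := discrepancy_le k wb M3.
have [Cd Cd0 hCd] := size_divisors_le e0.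
(* The cap at 1 ensures [1 <= H] below. *)
pose c := Num.min c1 1.
have c0 : 0 < c by rewrite lt_min c10 ltr01.
have cc1 : c <= c1 by rewrite ge_min lexx.
have c_1 : c <= 1 by rewrite ge_min lexx orbT.
(* The exponent of [H]: [k - s] from the Fourier sums up to [H], and [e] from the divisors. *)
pose p := k%:R - s + e.
pose C := 2 * (2 * K * c2) ^+ k * Cd * Cs * 2 ^+ M.+1 * (c^-1) `^ p.
have C0 : 0 <= C.
  by rewrite !mulr_ge0 ?powR_ge0 ?exprn_ge0 ?mulr_ge0 ?(ltW Cd0) ?(ltW Cs0) ?(ltW K0) ?(ltW c20).
exists C => N d dd y /andP[d0 d12] hdd hd.
have [->|N0] := posnP N.
  by rewrite big_geq // normr0 mulr_ge0 ?powR_ge0 // mulr_ge0 ?powR_ge0.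
have N1 : (1 : R) <= N%:R by rewrite ler1n.
have N0' : (0 : R) < N%:R by rewrite ltr0n.
pose x := N%:R `^ tau : R.
have x1 : 1 <= x by rewrite -(powRr0 N%:R) ler_powR // ltW.
have x0 : 0 < x by exact: lt_le_trans x1.
(* [H^-1] is a lower bound for every [dd j], so decay in [n * dd j * |xi j|] becomes decay in
   [|n * xi j| / H]. *)
pose H := x / (c * d).
have cd0 : 0 < c * d by rewrite mulr_gt0.
have H1 : 1 <= H by rewrite ler_pdivlMr // mul1r; nra.
have H0 : 0 < H by exact: lt_le_trans H1.
have ddH j : H^-1 <= dd j.
  have /andP[h _] := hd j; apply: le_trans h.
  rewrite /H invf_div powRN -/x mulrC mulrA ler_pM2r // mulrC ler_pM2r //.
  by rewrite invr_gt0.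
have ddU j : dd j <= c2 * x * d by have /andP[_] := hd j.
have dd0 j : 0 < dd j by have /andP[] := hdd j.
pose G0 := (K * (2 * N%:R * (c2 * x * d))) ^+ k.
have G00 : 0 < G0 by rewrite exprn_gt0 // !mulr_gt0.
pose T := Cs * 2 ^+ M.+1 * H `^ p.
have T0 : 0 < T by rewrite !mulr_gt0 ?exprn_gt0 ?powR_gt0.
pose E := G0 * (Cd * T).
have E0 : 0 < E by rewrite mulr_gt0 // mulr_gt0.
(* Over the [N] values of [n] the approximation errors add up to [E], the size of the main term. *)
pose delta := E / N%:R.
have delta0 : 0 < delta by rewrite divr_gt0.
pose F (xi : 'I_k -> int) := decay_weight H M xi * fourier_abs mu xi.
have F0 xi : 0 <= F xi.
  rewrite mulr_ge0 ?fourier_abs_ge0 // /decay_weight; case: ifP => // _.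
  by rewrite exprn_ge0 // divr_ge0 // ltW.
(* Indexing by a finite type allows [common_bound] to choose one degree for all [n]; the indices
   below [N] hold vacuously. *)
have step (n : 'I_(N.*2)) : exists L0, forall L, (L0 <= L)%N -> (N <= n)%N ->
    `|meas_int mu (Astar w n dd y) - leb_int (Astar w n dd y)| <= delta +
      G0 * \sum_(b : box k L | [exists j, boxv b j != 0]) F (dilate n (boxv b)).
  have [nN|Nn] := ltnP n N; first by exists 0%N.
  have n0 : (0 < n)%N by exact: leq_trans Nn.
  have n0' : (0 : R) < n%:R by rewrite ltr0n.
  have [L0 hL0] := hK mu n dd y delta mu1 n0 dd0 delta0.
  exists L0 => L L0L _; have [gam [g0 g1 g2 g3]] := hL0 L L0L.
  apply: le_trans g3 _; rewrite lerD2l mulr_sumr; apply: ler_sum => b bn.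
  rewrite /F mulrA ler_wpM2r ?fourier_abs_ge0 //.
  have GG : \prod_(j < k) (K * (n%:R * dd j)) <= G0.
    rewrite /G0 -[X in _ ^+ X](card_ord k) -prodr_const.
    apply: ler_prod => j _; rewrite !mulr_ge0 ?(ltW K0) ?(ltW (dd0 j)) //=.
    rewrite ler_pM2l // ler_pM // ?(ltW (dd0 j)) //.
    by rewrite -natrM ler_nat mul2n ltnW // ltn_ord.
  rewrite /decay_weight; case: ifPn => [_|].
    by rewrite mulr1; exact: le_trans (g1 b) GG.
  rewrite -ltNge => Hq.
  have q0 := lt_trans H0 Hq.
  (* The decay is used in a coordinate of maximal modulus, which turns it into decay in [maxabs]. *)
  have [j qj] := maxabs_attained bn.
  have := g2 b j; rewrite maxabs_dilate qj in Hq q0 *.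
  have qE : (n%:R * `|boxv b j|%:~R : R) = (n * absz (boxv b j))%N%:R.
    by rewrite natrM.
  move: Hq q0; rewrite -qE; set q := n%:R * _ => Hq q0 h.
  rewrite expr_div_n mulrA ler_pdivlMr ?exprn_gt0 //.
  have Hn0 : 0 < H ^+ M by rewrite exprn_gt0.
  rewrite -(ler_pM2r (_ : 0 < H ^- M)) ?invr_gt0 // mulfK ?gt_eqF //.
  apply: le_trans GG; apply: le_trans h.
  rewrite -[leLHS]mulrA ler_wpM2l // -exprVn -exprMn.
  have -> : n%:R * dd j * `|boxv b j|%:~R = q * dd j by rewrite /q mulrAC.
  apply: lerXn2r; rewrite ?nnegrE ?mulr_ge0 ?invr_ge0 ?(ltW q0) ?(ltW H0) ?(ltW (dd0 j)) //.
  by rewrite ler_pM2l.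
have [L0 hL] := common_bound step.
have {hL} hL := hL L0 (leqnn _).
(* One [E] for the approximation errors, one for the frequency sum. The exponent of [N] is
   [k + tau * k + tau * p] with [p <= k + eps / 2]; that of [d] is [k - p = s - e], above
   [dim_l1 mu - eps], and [d <= 1]. *)
apply: (@le_trans _ _ (E + E)); last first.
  have HE : H `^ p = x `^ p * ((c^-1) `^ p * (d^-1) `^ p).
    by rewrite /H invfM !powRM ?mulr_ge0 ?invr_ge0 ?(ltW x0) ?(ltW c0) ?(ltW d0).
  have G0E : G0 = (2 * K * c2) ^+ k * (N%:R ^+ k * x ^+ k * d ^+ k).
    by rewrite /G0 -!exprMn; congr (_ ^+ _); ring.
  have NE : N%:R ^+ k * x ^+ k * x `^ p = N%:R `^ (k%:R + tau * k%:R + tau * p).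
    rewrite -!powR_mulrn ?(ltW N0') ?(ltW x0) // /x -!powRrM.
    by rewrite -!powRD //; apply/implyP => _; rewrite gt_eqF.
  have dE : d ^+ k * (d^-1) `^ p = d `^ (k%:R - p).
    rewrite -powR_mulrn ?(ltW d0) // -powR_inv1 ?(ltW d0) // -powRrM mulN1r -powRD //.
    by apply/implyP => _; rewrite gt_eqF.
  have -> : E + E = C * ((N%:R ^+ k * x ^+ k * x `^ p) * (d ^+ k * (d^-1) `^ p)).
    by rewrite /E /C /T G0E HE; ring.
  rewrite -[leRHS]mulrA ler_wpM2l // NE dE ler_pM ?powR_ge0 //.
    apply: ler_powR => //; rewrite /p.
    have : 0 <= tau * s by rewrite mulr_ge0 // ltW.
    have : tau * e <= tau * (eps / 2) by rewrite ler_pM2l.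
    have : 0 < tau * eps by rewrite mulr_gt0.
    lra.
  apply: ger_powR; first by rewrite d0 /=; lra.
  by rewrite /p; lra.
apply: le_trans (ler_norm_sum _ _ _) _.
apply: (@le_trans _ _ (\sum_(N <= n < N.*2) (delta +
      G0 * \sum_(b : box k L0 | [exists j, boxv b j != 0]) F (dilate n (boxv b))))).
  by apply: ler_sum_nat => n /andP[Nn nN]; exact: (hL (Ordinal nN)).
have NN : (N.*2 - N = N)%N by rewrite -addnn addKn.
rewrite big_split /= sumr_const_nat NN; apply: lerD.
  by rewrite -mulr_natr divfK // gt_eqF.
rewrite -mulr_sumr ler_pM2l //.
apply: le_trans (sum_dilate_le L0 N0 F0) _.
set B := (N.*2 * L0)%N.
apply: (@le_trans _ _ (\sum_(m : box k B) Cd * ((maxabs (boxv m))%:R `^ e *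
    decay_weight H M (boxv m) * fourier_abs mu (boxv m)))).
  rewrite big_mkcond /=; apply: ler_sum => m _; case: ifPn => [mn|_].
    rewrite -mulrA mulrA ler_wpM2r //.
    exact: hCd (maxabs_gt0 mn).
  by rewrite mulr_ge0 ?(ltW Cd0) // -mulrA mulr_ge0 ?powR_ge0 //; exact: F0.
rewrite -mulr_sumr ler_pM2l // /T /p.
apply: dyadic_sum_le => //; try exact: ltW.
- by rewrite /M natrD; lra.
- exact: fourier_abs_ge0.
move=> Q Q1; rewrite -lee_fin; apply: le_trans (hCs Q Q1).
apply: (sum_le_esum (@boxv_inj k B)); first exact: fourier_abs_ge0.
move=> m mQ j; apply: le_trans mQ.
rewrite -[X in _ <= X]/((maxabs (boxv m))%:~R) ler_int -abszE.
exact: (leq_bigmax j).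
Qed.
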